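(* Let $\epsilon\in(0,1)$, let $T = \{ \tau_1, \dots, \tau_n \}$ be a set of polygonal curves in $\mathbb{R}^d$ of complexity at most $m$ each and let $\ell < m$. There exists a probability distribution over linear maps $f \colon \mathbb{R}^d \to \mathbb{R}^{d'}$, where $d' \in O(\epsilon^{-2}\,\ell\,\log (nm))$, such that with high probability over the choice of $f$, the following is true. For any polygonal curve $\tau$ with vertices $v^\tau_1, \dots, v^\tau_{\lvert \tau \rvert}$, define $F(\tau)$ to be the polygonal curve with vertices $f(v^\tau_1), \dots, f(v^\tau_{\lvert \tau \rvert})$. Then \[ \frac{1-\epsilon}{6\cdot(1+\epsilon)}\cdot r^{\ast}\leq r_f^{\ast} \leq (1+\epsilon)\cdot r^{\ast}, \] where $r^{\ast}$ is the cost of an optimal solution to the $(k,\ell)$-median problem on $T$, and $r_f^{\ast}$ is the cost of an optimal solution to the $(k,\ell)$-median problem on $F(T)=\{F(\tau):\tau\in T\}$.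
   Context: A curve is a continuous map $\tau\colon[0,1]\to\mathbb{R}^d$; it is polygonal if there are vertices $v_1,\dots,v_m$, no three consecutive on a line, and instants $0=t_1<\dots<t_m=1$ with $\tau(t_i)=v_i$ such that $\tau$ is linear between consecutive instants; $m=|\tau|$ is its complexity. Image curves $F(\tau)$ are piecewise linear through the listed vertices (non-collinearity not required). The Fréchet distance is $d_F(\sigma,\tau)=\inf_{a,b}\max_{t\in[0,1]}\|\sigma(a(t))-\tau(b(t))\|$ over continuous bijections $a,b$ of $[0,1]$ fixing $0$ and $1$. The $(k,\ell)$-median clustering problem on a given set $T$ of $n$ polygonal curves is to compute a set $C$ of $k$ polygonal curves in the same ambient space, of complexity at most $\ell$ each, minimizing the cost $\sum_{\tau\in T}\min_{c\in C}d_F(\tau,c)$; $k\in\mathbb{N}$ and $\ell\in\mathbb{N}_{\ge2}$ are constant parameters of the problem (the constant hidden in the bound on $d'$ may depend on $k$). For $F(T)$ the sum is over $\tau\in T$, i.e. images are counted with multiplicity. ''With high probability'' has the usual meaning: for any prescribed constant $c>0$, with probability at least $1-(nm)^{-c}$, the constant hidden in the bound on $d'$ being allowed to depend on $c$. *)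

(* Defs.v *)
From HB Require Import structures.
From mathcomp Require Export all_boot all_order all_algebra.
From mathcomp Require Export all_classical all_reals all_analysis.
Export Order.TTheory GRing.Theory Num.Theory numFieldNormedType.Exports.

Set Implicit Arguments.
Unset Strict Implicit.
Unset Printing Implicit Defensive.

Local Open Scope classical_set_scope.
Local Open Scope ring_scope.

(* The norm `|v| of MathComp-Analysis on row vectors is the sup norm. *)
Definition eucl_norm (R : realType) (d : nat) (v : 'rV[R]_d) : R :=
  Num.sqrt (\sum_i v 0 i ^+ 2).

(* [interp p s x] is the value at time [x] of the piecewise linear curve through
   the (instant, vertex) pairs [p :: s]; it is only meaningful for [x] between
   the first and the last instant. *)
Fixpoint interp (R : realType) (d : nat) (p : R * 'rV[R]_d)
    (s : seq (R * 'rV[R]_d)) (x : R) : 'rV[R]_d :=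
  if s is q :: s' then
    if x <= q.1 then p.2 + ((x - p.1) / (q.1 - p.1)) *: (q.2 - p.2)
    else interp q s' x
  else p.2.

(* A piecewise linear curve [0,1] -> R^d, given by its vertices together with
   the instants 0 = t_1 < ... < t_m = 1 at which they are visited.  The default
   values of [head] and [last] exclude the empty list, and 0 <> 1 excludes
   singletons, so that there are always at least two vertices. *)
Record plcurve (R : realType) (d : nat) := PLCurve {
  knots : seq (R * 'rV[R]_d);
  knots_sorted : sorted <%R (unzip1 knots);
  knots_head : head 1 (unzip1 knots) == 0;
  knots_last : last 0 (unzip1 knots) == 1 }.

Definition vertices (R : realType) (d : nat) (tau : plcurve R d) :
  seq 'rV[R]_d := unzip2 (knots tau).

Definition complexity (R : realType) (d : nat) (tau : plcurve R d) : nat :=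
  size (vertices tau).

Definition plcurve_eval (R : realType) (d : nat) (tau : plcurve R d) (x : R) :
    'rV[R]_d :=
  if knots tau is p :: s then interp p s x else 0.

Coercion plcurve_eval : plcurve >-> Funclass.

Definition on_a_line (R : realType) (d : nat) (A : set 'rV[R]_d) : Prop :=
  exists p e : 'rV[R]_d, e != 0 /\ A `<=` [set p + a *: e | a in [set: R]].

(* For curves satisfying this predicate the knots are determined by the
   underlying map on [0,1] (the interior vertices are exactly its kinks), so
   equality of such [plcurve]s is equality of the curves as maps, and
   [complexity] depends on the map only. *)
Definition polygonal (R : realType) (d : nat) (tau : plcurve R d) : Prop :=
  forall i : nat, (i.+2 < complexity tau)%N ->
    ~ on_a_line [set (vertices tau)`_i; (vertices tau)`_i.+1;
                     (vertices tau)`_i.+2].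

Section MapVertices.
Variables (R : realType) (d d' : nat).
Variables (f : 'rV[R]_d -> 'rV[R]_d') (tau : plcurve R d).

Let fknots := [seq (p.1, f p.2) | p <- knots tau].

Let fknots1 : unzip1 fknots = unzip1 (knots tau).
Proof. by rewrite /unzip1 -map_comp; apply: eq_map. Qed.

Let fknots_sorted : sorted <%R (unzip1 fknots).
Proof. by rewrite fknots1 knots_sorted. Qed.

Let fknots_head : head 1 (unzip1 fknots) == 0.
Proof. by rewrite fknots1 knots_head. Qed.

Let fknots_last : last 0 (unzip1 fknots) == 1.
Proof. by rewrite fknots1 knots_last. Qed.

(* The curve F(tau) through the images of the vertices of tau, visited at the
   same instants; it need not be [polygonal]. *)
Definition map_vertices : plcurve R d' :=
  PLCurve fknots_sorted fknots_head fknots_last.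

End MapVertices.

Definition reparametrization (R : realType) (a : R -> R) : Prop :=
  [/\ {within `[0, 1]%classic, continuous a}, set_bij `[0, 1] `[0, 1] a,
      a 0 = 0 & a 1 = 1].

(* The supremum over t is a maximum, by compactness. *)
Definition frechet_dist (R : realType) (d : nat) (sigma tau : R -> 'rV[R]_d) :
    R :=
  inf [set r | exists a b, [/\ reparametrization a, reparametrization b &
    r = sup [set eucl_norm (sigma (a t) - tau (b t)) | t in `[0, 1]]]].

(* [T] is indexed by 'I_n, so that curves are counted with multiplicity.  For a
   finite nonempty [C] the infimum over [C] is a minimum. *)
Definition median_cost (R : realType) (d n : nat) (T : 'I_n -> plcurve R d)
    (C : set (plcurve R d)) : R :=
  \sum_(i < n) inf [set frechet_dist (T i) c | c in C].

Definition median_candidate (R : realType) (d k l : nat)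
    (C : set (plcurve R d)) : Prop :=
  (C #= `I_k)%card /\
  forall c, C c -> polygonal c /\ (complexity c <= l)%N.

(* The optimal cost is an infimum: the class of candidates is not closed (limits
   of polygonal curves may have consecutive collinear vertices), so that an
   optimal solution need not exist. *)
Definition median_opt (R : realType) (d n k l : nat)
    (T : 'I_n -> plcurve R d) : R :=
  inf [set median_cost T C | C in @median_candidate R d k l].

(* The Borel space of d x d' matrices A, that is, of the linear maps
   v |-> v *m A from R^d to R^d'. *)
Definition borel_matrix (R : realType) (d d' : nat) :=
  g_sigma_algebraType (@open 'M[R]_(d, d')).

(* Main.v *)
Require Import Defs.
From mathcomp Require Import ring lra.

Set Implicit Arguments.
Unset Strict Implicit.
Unset Printing Implicit Defensive.

Local Open Scope classical_set_scope.
Local Open Scope ring_scope.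

(* Since the curves are given before the distribution is chosen, a point mass at
   one good matrix suffices, and such a matrix is found by derandomizing the
   Johnson-Lindenstrauss lemma: signs are chosen one after the other so that an
   exponential potential does not increase.

   Applied to the sums e_a + e_b of Gram-Schmidt bases, this makes the matrix a
   near-isometry on the span of any six vertices of the input curves and of one
   near-optimal family C of centres.  It therefore controls the distance between
   points of two edges, and between a point of an edge and a point of a segment
   joining two further edges.  The first fact bounds the cost of the image of C,
   whence the upper bound.  For the lower bound, a centre in the image space is
   replaced by a simplification of its closest input curve, whose vertices lie on
   that curve and hence lift to the original space; this costs a factor
   4 * (3 / 2) = 6.  The same argument in the other direction settles the upper
   bound when the optimal cost is 0, where C need not be near-optimal. *)

(** * The Johnson-Lindenstrauss lemma *)

Section Potential.
Variable R : realType.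
Implicit Types (a x y z : R).

(** For [z ^+ 2 <= 1 / 2], the bound [expR u <= (1 - u)^-1] at [z] and [- z] sums to
    [2 / (1 - z ^+ 2)], which is at most [2 * (1 + 2 * z ^+ 2)]. Otherwise [|z| <= 2 * z ^+ 2], and
    each exponential is bounded separately. *)
Lemma cosh_le_expR z : expR z + expR (- z) <= 2 * expR (2 * z ^+ 2).
Proof.
have [w2|w2] := lerP (z ^+ 2) (1 / 2).
  have z1 : -1 < z < 1 by apply/andP; split; nra.
  have inv_exp (u : R) : u < 1 -> expR u <= (1 - u)^-1.
    move=> u1; rewrite -[X in expR X]opprK expRN lef_pV2 ?posrE ?expR_gt0 ?subr_gt0 //.
    by have := expR_ge1Dx (- u); lra.
  have h1 := inv_exp z ltac:(lra); have h2 := inv_exp (- z) ltac:(lra).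
  have h3 := expR_ge1Dx (2 * z ^+ 2).
  have n1 : 1 - z != 0 by lra.
  have n2 : 1 - - z != 0 by lra.
  have n3 : 0 < 1 - z ^+ 2 by nra.
  have n3' : 1 - z ^+ 2 != 0 by lra.
  have h4 : (1 - z)^-1 + (1 - - z)^-1 = 2 * (1 - z ^+ 2)^-1.
    by field; rewrite n3' n2 n1.
  have h5 : (1 - z ^+ 2)^-1 <= 1 + 2 * z ^+ 2.
    by rewrite -div1r ler_pdivrMr //; nra.
  by lra.
have h : `|z| <= 2 * z ^+ 2.
  have := normr_ge0 z; move: w2; rewrite -(real_normK (num_real z)) => w2 u0.
  have hu : 1 / 2 <= `|z| by rewrite leNgt; apply/negP => hu; nra.
  nra.
have h1 : expR z <= expR (2 * z ^+ 2).
  by rewrite ler_expR (le_trans (ler_norm z)).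
have h2 : expR (- z) <= expR (2 * z ^+ 2).
  by rewrite ler_expR (le_trans (ler_norm (- z))) // normrN.
lra.
Qed.

(* Averaging over the sign of [x]; this is the step that makes
   [v |-> a + 16 a^2 v] a supersolution. *)
Lemma potential_step a v x y : `|a| <= 1 / 40 -> 0 <= v <= 1 ->
  expR ((a + 16 * a ^+ 2) * v + (a + 16 * a ^+ 2 * v) * (y + x) ^+ 2) +
  expR ((a + 16 * a ^+ 2) * v + (a + 16 * a ^+ 2 * v) * (y - x) ^+ 2) <=
  2 * expR ((a + 16 * a ^+ 2) * (v + x ^+ 2) +
            (a + 16 * a ^+ 2 * (v + x ^+ 2)) * y ^+ 2).
Proof.
rewrite ler_norml => /andP[a1 a2] /andP[v0 v1].
set m := a + 16 * a ^+ 2 * v.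
have a0 : 0 <= a ^+ 2 by nra.
(* The bound [1 / 40] enters here: [16 * a * v] has absolute value at most 2/5, and (7/5)^2 < 2. *)
have m2 : m ^+ 2 <= 2 * a ^+ 2.
  have -> : m ^+ 2 = a ^+ 2 * (1 + 16 * a * v) ^+ 2 by rewrite /m; ring.
  have h : -1 <= 40 * a * v <= 1 by apply/andP; split; nra.
  by rewrite mulrC ler_wpM2r //; nra.
have ma : m <= a + 16 * a ^+ 2 by rewrite /m; nra.
set b := (a + 16 * a ^+ 2).
have -> : b * v + m * (y + x) ^+ 2 = b * v + m * (y ^+ 2 + x ^+ 2) + 2 * m * x * y
  by ring.
have -> : b * v + m * (y - x) ^+ 2 = b * v + m * (y ^+ 2 + x ^+ 2) + - (2 * m * x * y)
  by ring.
rewrite !(expRD (b * v + m * _)) -mulrDr.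
(* The cross terms cost at most [8 * m ^+ 2 * x ^+ 2 * y ^+ 2], which the growth of the coefficient
   of [y ^+ 2] absorbs. *)
apply: (le_trans (ler_wpM2l (expR_ge0 _) (cosh_le_expR _))).
rewrite mulrCA -expRD ler_wpM2l // ler_expR.
have x0 : 0 <= x ^+ 2 by apply: sqr_ge0.
have xy0 : 0 <= x ^+ 2 * y ^+ 2 by rewrite mulr_ge0 ?sqr_ge0.
have e1 : 2 * (2 * m * x * y) ^+ 2 = 8 * m ^+ 2 * (x ^+ 2 * y ^+ 2) by ring.
have e2 : (a + 16 * a ^+ 2 * (v + x ^+ 2)) * y ^+ 2 =
  m * y ^+ 2 + 16 * a ^+ 2 * (x ^+ 2 * y ^+ 2) by rewrite /m; ring.
rewrite e1 e2.
have h1 : 8 * m ^+ 2 * (x ^+ 2 * y ^+ 2) <= 16 * a ^+ 2 * (x ^+ 2 * y ^+ 2).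
  by rewrite ler_wpM2r //; lra.
have h2 : m * x ^+ 2 <= b * x ^+ 2 by rewrite ler_wpM2r.
by lra.
Qed.

(** Method of conditional expectations: [y] carries the part of the sum whose signs are already
    fixed. The induction peels off the last sign and applies the hypothesis to both of its
    values. *)
Lemma exists_signs (I : finType) (w a : I -> R) (p : nat) (y : I -> R)
    (x : I -> nat -> R) :
  (forall t, 0 <= w t) -> (forall t, `|a t| <= 1 / 40) ->
  (forall t, \sum_(i < p) x t i ^+ 2 <= 1) ->
  exists s : nat -> R,
  \sum_t w t * expR (a t * (y t + \sum_(i < p) s i * x t i) ^+ 2) <=
  \sum_t w t * expR ((a t + 16 * a t ^+ 2) * (\sum_(i < p) x t i ^+ 2) +
    (a t + 16 * a t ^+ 2 * (\sum_(i < p) x t i ^+ 2)) * y t ^+ 2).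
Proof.
move=> w0 a1; elim: p y => [|p IH] y x1.
  exists (fun=> 0); apply: ler_sum => t _.
  by rewrite !big_ord0 !mulr0 add0r !addr0.
have x1' t : \sum_(i < p) x t i ^+ 2 <= 1.
  by apply: le_trans (x1 t); rewrite big_ord_recr /= lerDl sqr_ge0.
have [s1 h1] := IH (fun t => y t + x t p) x1'.
have [s2 h2] := IH (fun t => y t - x t p) x1'.
set A1 := \sum_t _ in h1; set B1 := \sum_t _ in h1.
set A2 := \sum_t _ in h2; set B2 := \sum_t _ in h2.
set C := (X in exists s, _ <= X).
(* By [potential_step] the two bounds average to at most [C], so one of the two signs keeps the
   potential below [C]. *)
have hC : B1 + B2 <= 2 * C.
  rewrite /B1 /B2 /C -big_split mulr_sumr; apply: ler_sum => t _ /=.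
  rewrite -mulrDr [leRHS]mulrCA ler_wpM2l // big_ord_recr /=.
  apply: potential_step => //; rewrite x1' andbT.
  by apply: sumr_ge0 => i _; rewrite sqr_ge0.
have ext (s : nat -> R) (e : R) : \sum_t w t * expR (a t * (y t +
    \sum_(i < p.+1) (fun j => if j == p then e else s j) i * x t i) ^+ 2) =
  \sum_t w t * expR (a t * (y t + e * x t p + \sum_(i < p) s i * x t i) ^+ 2).
  apply: eq_bigr => t _; congr (_ * expR (_ * _ ^+ 2)).
  rewrite big_ord_recr /= eqxx [_ + e * _]addrC addrA; congr (_ + _).
  by apply: eq_bigr => i _; rewrite ltn_eqF.
have [A1C|A1C] := lerP A1 C.
  exists (fun j => if j == p then 1 else s1 j); rewrite ext.
  by apply: le_trans A1C; under eq_bigr do rewrite mul1r.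
exists (fun j => if j == p then -1 else s2 j); rewrite ext.
have : A2 <= C by lra.
by apply: le_trans; under eq_bigr do rewrite mulN1r.
Qed.

End Potential.

(** * Inner product and Euclidean norm *)

Section Euclid.
Variables (R : realType) (d : nat).
Implicit Types (u v w : 'rV[R]_d) (a : R).

Definition dot u v : R := \sum_i u 0 i * v 0 i.

Lemma dotC u v : dot u v = dot v u.
Proof. by apply: eq_bigr => i _; rewrite mulrC. Qed.

Lemma dotDl u v w : dot (u + v) w = dot u w + dot v w.
Proof. by rewrite -big_split; apply: eq_bigr => i _; rewrite mxE mulrDl. Qed.

Lemma dotZl a u v : dot (a *: u) v = a * dot u v.
Proof. by rewrite mulr_sumr; apply: eq_bigr => i _; rewrite mxE mulrA. Qed.

Lemma dotDr u v w : dot u (v + w) = dot u v + dot u w.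
Proof. by rewrite !(dotC u) dotDl. Qed.

Lemma dotZr a u v : dot u (a *: v) = a * dot u v.
Proof. by rewrite !(dotC u) dotZl. Qed.

Lemma dot0l v : dot 0 v = 0.
Proof. by rewrite -(scale0r v) dotZl mul0r. Qed.

Lemma dot_suml (I : finType) (f : I -> 'rV[R]_d) v :
  dot (\sum_i f i) v = \sum_i dot (f i) v.
Proof.
exact: (big_morph (fun u => dot u v) (fun u w => dotDl u w v) (dot0l v)).
Qed.

Lemma dot_sumr (I : finType) (f : I -> 'rV[R]_d) v :
  dot v (\sum_i f i) = \sum_i dot v (f i).
Proof. by rewrite dotC dot_suml; apply: eq_bigr => i _; rewrite dotC. Qed.

Lemma dot_ge0 u : 0 <= dot u u.
Proof. by apply: sumr_ge0 => i _; rewrite -expr2 sqr_ge0. Qed.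

Lemma dot_eq0 u : (dot u u == 0) = (u == 0).
Proof.
apply/eqP/eqP => [/eqP|->]; last exact: dot0l.
rewrite psumr_eq0 => [/allP u0|i _]; last by rewrite -expr2 sqr_ge0.
apply/rowP => i; have := u0 i (mem_index_enum _).
by rewrite mxE mulf_eq0 orbb => /eqP.
Qed.

Lemma eucl_normE u : eucl_norm u = Num.sqrt (dot u u).
Proof. by congr Num.sqrt; apply: eq_bigr => i _; rewrite expr2. Qed.

Lemma eucl_norm_ge0 u : 0 <= eucl_norm u.
Proof. exact: sqrtr_ge0. Qed.

Lemma eucl_norm_sqr u : eucl_norm u ^+ 2 = dot u u.
Proof. by rewrite eucl_normE sqr_sqrtr ?dot_ge0. Qed.

Lemma eucl_norm_eq0 u : (eucl_norm u == 0) = (u == 0).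
Proof. by rewrite -sqrf_eq0 eucl_norm_sqr dot_eq0. Qed.

Lemma eucl_normZ a u : eucl_norm (a *: u) = `|a| * eucl_norm u.
Proof.
by rewrite !eucl_normE dotZl dotZr mulrA -expr2 sqrtrM ?sqr_ge0 ?sqrtr_sqr.
Qed.

Lemma eucl_normN u : eucl_norm (- u) = eucl_norm u.
Proof. by rewrite -scaleN1r eucl_normZ normrN1 mul1r. Qed.

Lemma eucl_norm0 : eucl_norm (0 : 'rV[R]_d) = 0.
Proof. by rewrite eucl_normE dot0l sqrtr0. Qed.

Lemma eucl_normB u v : eucl_norm (u - v) = eucl_norm (v - u).
Proof. by rewrite -eucl_normN opprB. Qed.

Lemma cauchy_schwarz u v : dot u v <= eucl_norm u * eucl_norm v.
Proof.
set a := eucl_norm u; set b := eucl_norm v.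
have a0 : 0 <= a := eucl_norm_ge0 u; have b0 : 0 <= b := eucl_norm_ge0 v.
have := dot_ge0 (b *: u + (- a) *: v).
rewrite !dotDl !dotDr !dotZl !dotZr (dotC v u) -!eucl_norm_sqr -/a -/b => h.
have [|an0] := eqVneq a 0.
  by move/eqP; rewrite eucl_norm_eq0 => /eqP->; rewrite dot0l mulr_ge0.
have [|bn0] := eqVneq b 0.
  by move/eqP; rewrite eucl_norm_eq0 => /eqP->; rewrite dotC dot0l mulr_ge0.
have ab : 0 < a * b by rewrite mulr_gt0 // lt_neqAle eq_sym ?an0 ?bn0.
rewrite -(ler_pM2l ab); nra.
Qed.

Lemma eucl_normD u v : eucl_norm (u + v) <= eucl_norm u + eucl_norm v.
Proof.
rewrite -ler_sqr ?nnegrE ?addr_ge0 ?eucl_norm_ge0 //.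
rewrite eucl_norm_sqr dotDl !dotDr (dotC v u) sqrrD !eucl_norm_sqr.
by have := cauchy_schwarz u v; lra.
Qed.

Lemma eucl_norm_conv a u v r : 0 <= a <= 1 -> eucl_norm u <= r ->
  eucl_norm v <= r -> eucl_norm ((1 - a) *: u + a *: v) <= r.
Proof.
move=> /andP[a0 a1] ur vr; apply: (le_trans (eucl_normD _ _)).
rewrite !eucl_normZ !ger0_norm ?subr_ge0 //.
have : (1 - a) * eucl_norm u <= (1 - a) * r by rewrite ler_wpM2l ?subr_ge0.
have : a * eucl_norm v <= a * r by rewrite ler_wpM2l.
by lra.
Qed.

End Euclid.

(** One column at a time. The first [N] columns are chosen with weights that anticipate the bound
    for the last one; the last is then chosen with weights that record the potential actually
    reached. *)
Lemma exists_sign_columns (R : realType) (I : finType) (a : I -> R) (p : nat)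
    (x : I -> nat -> R) (N : nat) (w : I -> R) :
  (forall t, 0 <= w t) -> (forall t, `|a t| <= 1 / 40) ->
  (forall t, \sum_(i < p) x t i ^+ 2 <= 1) ->
  exists s : nat -> nat -> R,
  \sum_t w t * expR (a t * \sum_(j < N) (\sum_(i < p) s j i * x t i) ^+ 2) <=
  \sum_t w t * expR ((a t + 16 * a t ^+ 2) * (\sum_(i < p) x t i ^+ 2) * N%:R).
Proof.
move=> w0 a1 x1; elim: N w w0 => [|N IH] w w0.
  exists (fun _ _ => 0); apply: ler_sum => t _.
  by rewrite big_ord0 !mulr0.
set v := fun t => \sum_(i < p) x t i ^+ 2.
have [s hs] := IH (fun t => w t * expR ((a t + 16 * a t ^+ 2) * v t))
  (fun t => mulr_ge0 (w0 t) (expR_ge0 _)).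
set W := fun t => w t * expR (a t * \sum_(j < N) (\sum_(i < p) s j i * x t i) ^+ 2).
have W0 t : 0 <= W t by rewrite mulr_ge0 ?expR_ge0.
have [s' hs'] := @exists_signs R I W a p (fun=> 0) x W0 a1 x1.
exists (fun j => if j == N then s' else s j).
apply: (le_trans _ (le_trans (le_trans hs' _) (le_trans hs _))).
- apply: ler_sum => t _; rewrite big_ord_recr /= eqxx mulrDr expRD mulrA add0r.
  rewrite ler_wpM2r ?expR_ge0 // ler_wpM2l // le_eqVlt; apply/orP; left.
  apply/eqP; congr (expR (_ * _)); apply: eq_bigr => j _.
  by rewrite ltn_eqF.
- apply: ler_sum => t _; rewrite expr0n /= mulr0 addr0 /W.
  by rewrite -!mulrA ler_wpM2l // mulrC.
- apply: ler_sum => t _; rewrite -mulrA ler_wpM2l // -expRD ler_expR.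
  by rewrite -(natr1 N) [leRHS]mulrDr mulr1 addrC.
Qed.

(** An exponential-moment union bound: each nonzero vector contributes one term per tail, and a
    violated tail would make its term at least 1. As the potential stays below 1, none is
    violated. *)
Lemma johnson_lindenstrauss (R : realType) (d N : nat) (I : finType)
    (x : I -> 'rV[R]_d) (e : R) :
  0 < e <= 1 -> 2 * #|I|%:R * expR (- (3 / 200 * e ^+ 2 * N%:R)) < 1 ->
  exists A : 'M[R]_(d, N),
    forall t, `|dot (x t *m A) (x t *m A) - dot (x t) (x t)| <= e * dot (x t) (x t).
Proof.
move=> /andP[e0 e1] hN.
have [I0|I0] := posnP #|I|.
  by exists 0 => t; have := fintype0 t I0.
have {I0} N0 : 0 < N%:R :> R.
  rewrite ltr0n lt0n; apply/eqP => N0; move: hN.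
  rewrite N0 mulr0 oppr0 expR0 mulr1 -natrM ltrn1.
  by case: #|I| I0.
pose nx t := eucl_norm (x t).
(* Coordinates of the normalised vector, extended by 0 beyond [d]. Since the inverse of 0 is 0, null
   vectors give 0. *)
pose y (q : I * bool) i : R := (nx q.1)^-1 * oapp (x q.1 0) 0 (insub i).
pose a (q : I * bool) : R := (-1) ^+ q.2 * (e / 40).
(* The boolean selects the tail. Each term is finally bounded by the exponential of
   [-3 / 200 * e ^+ 2 * N], because 1/40 - 16/40^2 = 3/200. *)
pose w (q : I * bool) : R :=
  if nx q.1 == 0 then 0 else expR (- (a q * N%:R) - e ^+ 2 / 40 * N%:R).
have w0 q : 0 <= w q by rewrite /w; case: ifP => // _; exact: expR_ge0.
have a1 q : `|a q| <= 1 / 40.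
  by rewrite /a normrM normrX normrN1 expr1n mul1r ger0_norm; lra.
have yE q : \sum_(i < d) y q i ^+ 2 = (nx q.1 != 0)%:R.
  transitivity ((nx q.1)^-2 * dot (x q.1) (x q.1)).
    rewrite mulr_sumr; apply: eq_bigr => i _.
    by rewrite /y valK /= exprMn exprVn expr2.
  rewrite -eucl_norm_sqr -/(nx _); have [->|n0] := eqVneq (nx q.1) 0.
    by rewrite expr0n mulr0.
  by rewrite mulVf // expf_neq0.
have y1 q : \sum_(i < d) y q i ^+ 2 <= 1 by rewrite yE lern1 leq_b1.
have [s hs] := exists_sign_columns N w0 a1 y1.
have {}hs : \sum_q w q * expR (a q * \sum_(j < N) (\sum_(i < d) s j i * y q i) ^+ 2) < 1.
  apply: (le_lt_trans hs); apply: le_lt_trans hN.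
  apply: (@le_trans _ _ (\sum_(q : I * bool) expR (- (3 / 200 * e ^+ 2 * N%:R)))).
    apply: ler_sum => q _; rewrite yE /w; case: eqP => _.
      by rewrite mul0r expR_ge0.
    rewrite mulr1 -expRD ler_expR.
    have -> : a q ^+ 2 = e ^+ 2 / 1600.
      by rewrite /a exprMn sqrr_sign mul1r; field.
    by lra.
  by rewrite sumr_const card_prod card_bool -[leLHS]mulr_natl natrM [_%:R * 2]mulrC.
exists (\matrix_(i < d, j < N) (s j i / Num.sqrt N%:R)) => t.
have [t0|t0] := eqVneq (nx t) 0.
  have xt0 : x t = 0 by apply/eqP; rewrite -eucl_norm_eq0 -/(nx t) t0.
  by rewrite xt0 mul0mx !dot0l subr0 normr0 mulr0.
set S := \sum_(j < N) (\sum_(i < d) s j i * y (t, true) i) ^+ 2.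
have SE b : \sum_(j < N) (\sum_(i < d) s j i * y (t, b) i) ^+ 2 = S by [].
(* A single nonnegative term of a sum below 1 is below 1, so its exponent is negative. *)
have hb b : a (t, b) * S < a (t, b) * N%:R + e ^+ 2 / 40 * N%:R.
  suff : expR (a (t, b) * S - (a (t, b) * N%:R + e ^+ 2 / 40 * N%:R)) < 1.
    by rewrite expR_lt1 subr_lt0.
  apply: le_lt_trans hs; rewrite (bigD1 (t, b)) //= SE.
  rewrite {1}/w /= (negbTE t0) opprD [a _ * S + _]addrC expRD.
  by rewrite lerDl; apply: sumr_ge0 => q _; rewrite mulr_ge0 ?expR_ge0.
have := hb true; have := hb false; rewrite /a /= expr0 expr1 => h1 h2.
have AE : dot (x t *m \matrix_(i < d, j < N) (s j i / Num.sqrt N%:R))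
              (x t *m \matrix_(i < d, j < N) (s j i / Num.sqrt N%:R)) =
          S * dot (x t) (x t) / N%:R.
  have -> : S * dot (x t) (x t) / N%:R = S * (nx t / Num.sqrt N%:R) ^+ 2.
    by rewrite expr_div_n (sqr_sqrtr (ler0n R N)) eucl_norm_sqr mulrA.
  rewrite mulr_suml; apply: eq_bigr => j _; rewrite -expr2 -exprMn; congr (_ ^+ 2).
  rewrite mxE mulr_suml; apply: eq_bigr => i _.
  rewrite mxE /y valK /=; rewrite mulrA (mulrAC _ (s j i)); field.
  by rewrite t0 sqrtr_eq0 -ltNge N0.
rewrite AE; set D := dot _ _; have D0 : 0 <= D := dot_ge0 _.
have -> : S * D / N%:R - D = (S / N%:R - 1) * D by field; rewrite gt_eqF.
rewrite normrM (ger0_norm D0) ler_wpM2r // ler_norml.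
have u1 : S < (1 + e) * N%:R by nra.
have u2 : (1 - e) * N%:R < S by nra.
rewrite lerBrDr lerBlDr ler_pdivlMr // ler_pdivrMr //.
by apply/andP; split; lra.
Qed.

(** * Near-isometries on spans of few points *)

(* The vectors [e a] are either null or normalised, so that no rank has to be
   mentioned. *)
Lemma gram_schmidt (R : realType) (d : nat) (x : nat -> 'rV[R]_d) (p : nat) :
  exists e : nat -> 'rV[R]_d,
    (forall a b, (a < p)%N -> (b < p)%N ->
      dot (e a) (e b) = ((a == b) && (e a != 0))%:R) /\
    (forall i, (i < p)%N ->
      exists u : nat -> R, x i = \sum_(a < p) u a *: e a).
Proof.
elim: p => [|p [e [eo ex]]]; first by exists (fun=> 0).
pose r := x p - \sum_(a < p) dot (x p) (e a) *: e a.
have re b : (b < p)%N -> dot r (e b) = 0.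
  move=> bp; rewrite /r -scaleN1r dotDl dotZl dot_suml mulN1r.
  rewrite (bigD1 (Ordinal bp)) //= big1 ?addr0 => [|a ab].
    rewrite dotZl eo // eqxx /=; have [->|_] := eqVneq (e b) 0.
      by rewrite mulr0 dotC dot0l subr0.
    by rewrite mulr1 subrr.
  by rewrite dotZl eo // -(inj_eq val_inj) /= in ab *; rewrite (negbTE ab) mulr0.
pose f := (eucl_norm r)^-1 *: r.
pose e' a := if a == p then f else e a.
have e'lt a : (a < p)%N -> e' a = e a by move=> ap; rewrite /e' ltn_eqF.
have e'p : e' p = f by rewrite /e' eqxx.
have ff : dot f f = (f != 0)%:R.
  have [->|f0] := eqVneq f 0; first by rewrite dot0l.
  rewrite /f dotZl dotZr -eucl_norm_sqr.
  have r0 : eucl_norm r != 0.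
    by apply: contra f0; rewrite /f => /eqP->; rewrite invr0 scale0r.
  by rewrite mulrA expr2 mulrACA mulVf // mulr1.
exists e'; split => [a b|i].
  rewrite !ltnS (leq_eqVlt a) (leq_eqVlt b) => /predU1P[->|ap] /predU1P[->|bp].
  - by rewrite e'p eqxx ff.
  - by rewrite e'p e'lt // /f dotZl re // mulr0 gtn_eqF.
  - by rewrite e'p e'lt // dotC /f dotZl re // mulr0 ltn_eqF.
  - by rewrite !e'lt // eo.
rewrite ltnS leq_eqVlt => /predU1P[->|ip].
  exists (fun a => if a == p then eucl_norm r else dot (x p) (e a)).
  rewrite big_ord_recr /= eqxx e'p.
  rewrite (eq_bigr (fun a : 'I_p => dot (x p) (e a) *: e a)); last first.
    by move=> a _; rewrite e'lt // ltn_eqF.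
  have -> : eucl_norm r *: f = r.
    have [/eqP|r0] := eqVneq (eucl_norm r) 0.
      by rewrite eucl_norm_eq0 /f => /eqP->; rewrite !scaler0.
    by rewrite scalerA divff ?scale1r.
  by rewrite /r addrC subrK.
have [u ->] := ex i ip.
exists (fun a => if a == p then 0 else u a).
rewrite big_ord_recr /= eqxx scale0r addr0; apply: eq_bigr => a _.
by rewrite e'lt // ltn_eqF.
Qed.

(** By polarisation the hypothesis on the sums [e a + e b] bounds every entry of the error [g] of
    the Gram matrix by [2 * h]. The quadratic form of [g] is then controlled through 2|xy| <= x^2 +
    y^2. *)
Lemma near_isometry_span (R : realType) (d N p : nat) (A : 'M[R]_(d, N))
    (e : 'I_p -> 'rV[R]_d) (h : R) (u : 'I_p -> R) :
  0 <= h ->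
  (forall a b, dot (e a) (e b) = ((a == b) && (e a != 0))%:R) ->
  (forall a b, `|dot ((e a + e b) *m A) ((e a + e b) *m A) -
                 dot (e a + e b) (e a + e b)| <=
               h * dot (e a + e b) (e a + e b)) ->
  let v := \sum_a u a *: e a in
  `|dot (v *m A) (v *m A) - dot v v| <= 2 * p%:R * h * dot v v.
Proof.
rewrite /= => h0 eo eA; set v := \sum_a _.
(* Dropping the coefficients of null vectors makes [dot v v] exactly the sum of the squares of the
   coefficients. *)
pose c a := if e a == 0 then 0 else u a.
have vE : v = \sum_a c a *: e a.
  by apply: eq_bigr => a _; rewrite /c; case: eqP => // ->; rewrite !scaler0.
have vv : dot v v = \sum_a c a ^+ 2.
  rewrite {1}vE dot_suml; apply: eq_bigr => a _.
  rewrite vE dot_sumr (bigD1 a) //= big1 => [|b ba].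
    rewrite dotZl dotZr eo eqxx addr0 /c; case: eqP => /= _; first by rewrite !mul0r expr0n.
    by rewrite mulr1 expr2.
  by rewrite dotZl dotZr eo eq_sym (negbTE ba) !mulr0.
have vAE : v *m A = \sum_a c a *: (e a *m A).
  by rewrite vE mulmx_suml; apply: eq_bigr => a _; rewrite -scalemxAl.
pose g a b := dot (e a *m A) (e b *m A) - dot (e a) (e b).
have diffE : dot (v *m A) (v *m A) - dot v v = \sum_a \sum_b c a * c b * g a b.
  rewrite vAE {1 2}vE !dot_suml -sumrB; apply: eq_bigr => a _.
  rewrite !dot_sumr -sumrB; apply: eq_bigr => b _.
  by rewrite !dotZl !dotZr /g; ring.
have ee a : 0 <= dot (e a) (e a) <= 1.
  by rewrite eo eqxx ler0n lern1 leq_b1.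
have hee a : h * dot (e a) (e a) <= h.
  by have /andP[_ D1] := ee a; rewrite ler_piMr.
have sumE (n : nat) (x y : 'rV[R]_n) :
    dot (x + y) (x + y) = dot x x + 2 * dot x y + dot y y.
  by rewrite dotDl !dotDr (dotC y x); ring.
have gaa a : `|g a a| <= h.
  have := eA a a; rewrite mulmxDl !sumE /g.
  have := hee a; set D := dot (e a) _; set D' := dot (e a *m A) _ => hD.
  have -> : D' + 2 * D' + D' - (D + 2 * D + D) = 4 * (D' - D) by ring.
  rewrite normrM ger0_norm // => H; lra.
have gab a b : `|g a b| <= 2 * h.
  have [<-|ab] := eqVneq a b; first by apply: le_trans (gaa a) _; lra.
  have := eA a b; rewrite mulmxDl !sumE => H.
  have := gaa a; have := gaa b; move: H; rewrite /g !ler_norml.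
  have -> : dot (e a) (e b) = 0 by rewrite eo (negbTE ab).
  rewrite mulr0 addr0 mulrDr; have := hee a; have := hee b.
  by move=> ? ? /andP[? ?] /andP[? ?] /andP[? ?]; apply/andP; split; lra.
rewrite diffE vv; apply: (le_trans (ler_norm_sum _ _ _)).
apply: (@le_trans _ _ (\sum_a \sum_b (h * c a ^+ 2 + h * c b ^+ 2))).
  apply: ler_sum => a _; apply: (le_trans (ler_norm_sum _ _ _)).
  apply: ler_sum => b _; rewrite normrM normrM.
  have hab : 2 * (`|c a| * `|c b|) <= c a ^+ 2 + c b ^+ 2.
    rewrite -(real_normK (num_real (c a))) -(real_normK (num_real (c b))).
    by have := sqr_ge0 (`|c a| - `|c b|); nra.
  apply: (@le_trans _ _ (`|c a| * `|c b| * (2 * h))).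
    by rewrite ler_wpM2l // mulr_ge0.
  by have := ler_wpM2l h0 hab; lra.
under eq_bigr => a _ do rewrite big_split /= sumr_const card_ord -mulr_sumr.
rewrite big_split /= sumr_const card_ord.
under eq_bigr => a _ do rewrite -mulr_natl mulrCA.
by rewrite -!mulr_sumr -mulr_natl; lra.
Qed.

(** Each [p]-tuple of points gets its own Gram-Schmidt basis, whence [#|J| ^ p * (p * p)] sums of
    two basis vectors. The accuracy [h / (2 * p%:R)] cancels the loss in [near_isometry_span]. *)
Lemma embed_combinations (R : realType) (d N p : nat) (J : finType)
    (pt : J -> 'rV[R]_d) (h : R) :
  0 < h <= 1 -> (0 < p)%N ->
  2 * (#|J| ^ p * (p * p))%:R *
    expR (- (3 / 200 * (h / (2 * p%:R)) ^+ 2 * N%:R)) < 1 ->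
  exists A : 'M[R]_(d, N), forall (j : 'I_p -> J) (u : 'I_p -> R),
    let v := \sum_a u a *: pt (j a) in
    `|dot (v *m A) (v *m A) - dot v v| <= h * dot v v.
Proof.
move=> /andP[h0 h1] p0 hN.
have p1 : 1 <= p%:R :> R by rewrite ler1n.
have basis (j : {ffun 'I_p -> J}) : exists e : 'I_p -> 'rV[R]_d,
    (forall a b, dot (e a) (e b) = ((a == b) && (e a != 0))%:R) /\
    (forall i, exists u : 'I_p -> R, pt (j i) = \sum_a u a *: e a).
  have [e [eo ex]] := gram_schmidt (fun i => pt (j (insubd (Ordinal p0) i))) p.
  exists (fun a => e a); split => [a b|i].
    by rewrite eo.
  have [u] := ex i (ltn_ord i); rewrite valKd => ->.
  by exists (fun a => u a).
have [e he] := choice basis.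
pose x (q : {ffun 'I_p -> J} * ('I_p * 'I_p)) := e q.1 q.2.1 + e q.1 q.2.2.
have hh : 0 < h / (2 * p%:R) <= 1.
  by rewrite divr_gt0 ?mulr_gt0 ?ltr0n //= ler_pdivrMr; lra.
have [|A hA] := johnson_lindenstrauss (N := N) x hh.
  by rewrite !card_prod card_ffun !card_ord.
exists A => j u /=; set v := \sum_a _.
pose j' := [ffun a => j a].
have [eo ex] := he j'.
have [c hc] := choice ex.
have vE : v = \sum_b (\sum_a u a * c a b) *: e j' b.
  under eq_bigr do rewrite scaler_suml.
  rewrite exchange_big /=; apply: eq_bigr => a _.
  have := hc a; rewrite ffunE => ->; rewrite scaler_sumr.
  by apply: eq_bigr => b _; rewrite scalerA.
have -> : h * dot v v = 2 * p%:R * (h / (2 * p%:R)) * dot v v.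
  by field; rewrite pnatr_eq0 -lt0n.
rewrite vE; apply: near_isometry_span => //; first by case/andP: hh => /ltW.
by move=> a b; exact: (hA (j', (a, b))).
Qed.

(** * Frechet distance and piecewise linear curves *)

Section Reparametrization.
Variable R : realType.
Implicit Types (f g h : R -> R) (r : R).

Lemma reparam_itv f t : reparametrization f -> t \in `[0, 1] -> f t \in `[0, 1].
Proof. by case=> _ [ff _ _] _ _ t01; exact: ff. Qed.

Lemma reparam_mono f : reparametrization f ->
  {in `[0, 1] &, {mono f : x y / x <= y}}.
Proof.
case=> fc [_ fi _] f0 f1; apply: segment_continuous_inj_le => //.
  by rewrite f0 f1.
by move=> x y x01 y01; apply: fi; rewrite inE.
Qed.

Lemma reparam_of_mono f : f 0 = 0 -> f 1 = 1 ->
  {in `[0, 1] &, {mono f : x y / x <= y}} -> set_surj `[0, 1] `[0, 1] f ->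
  reparametrization f.
Proof.
move=> f0 f1 fm fs; have z01 : (0 : R) \in `[0, 1] by rewrite bound_itvE.
have o01 : (1 : R) \in `[0, 1] by rewrite bound_itvE.
split => //; first by apply: segment_inc_surj_continuous; rewrite ?f0 ?f1.
split => //.
  move=> t /= t01; have := t01; rewrite !in_itv /= => /andP[t0 t1].
  by apply/andP; split; [rewrite -f0|rewrite -f1]; rewrite fm.
by move=> x y; rewrite !inE; exact: inc_inj_in fm x y.
Qed.

Lemma reparam_id : reparametrization (@idfun R).
Proof. by apply: reparam_of_mono => // t t01; exists t. Qed.

Lemma reparam_comp f g : reparametrization f -> reparametrization g ->
  reparametrization (f \o g).
Proof.
move=> rf rg; have [_ [_ _ sf] f0 f1] := rf; have [_ [_ _ sg] g0 g1] := rg.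
apply: reparam_of_mono; rewrite /= ?g0 ?g1 //.
  by move=> x y x01 y01; rewrite /= !reparam_mono ?reparam_itv.
by move=> z /sf[y /sg[x x01 <-] <-]; exists x.
Qed.

Lemma reparam_inv f : reparametrization f ->
  exists2 g, reparametrization g & {in `[0, 1], cancel g f}.
Proof.
move=> rf; have [_ [_ fi sf] f0 f1] := rf.
have z01 : (0 : R) \in `[0, 1] by rewrite bound_itvE.
have o01 : (1 : R) \in `[0, 1] by rewrite bound_itvE.
have /choice[g gP] : forall y, exists x, y \in `[0, 1] -> x \in `[0, 1] /\ f x = y.
  move=> y; have [y01|_] := boolP (y \in `[0, 1]); last by exists 0.
  by have [x x01 <-] := sf y y01; exists x.
have gi y : y \in `[0, 1] -> g y \in `[0, 1] by case/gP.
have fg y : y \in `[0, 1] -> f (g y) = y by case/gP.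
have finj : {in `[0, 1] &, injective f} := inc_inj_in (reparam_mono rf).
exists g => //; apply: reparam_of_mono.
- by apply: finj; rewrite ?gi // fg.
- by apply: finj; rewrite ?gi // fg.
- by move=> x y x01 y01; rewrite -(reparam_mono rf) ?gi // !fg.
- move=> y y01; exists (f y); first exact: reparam_itv.
  by apply: finj; rewrite ?gi ?fg ?reparam_itv.
Qed.

End Reparametrization.

Section FrechetLe.
Variables (R : realType) (d : nat).
Implicit Types (s t u : R -> 'rV[R]_d) (r : R).

(** One reparametrization is enough, as the other can be inverted. Unlike a bound on [frechet_dist],
    this supplies an actual matching, which can be carried over to other curves. *)
Definition frechet_le s t r : Prop :=
  exists2 h, reparametrization h &
    forall x, x \in `[0, 1] -> eucl_norm (s (h x) - t x) <= r.

Lemma frechet_le_sym s t r : frechet_le s t r -> frechet_le t s r.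
Proof.
case=> h rh hP; have [g rg hg] := reparam_inv rh.
exists g => // x x01; rewrite eucl_normB -[X in s X](hg x x01).
exact/hP/reparam_itv.
Qed.

Lemma frechet_le_trans t s u r1 r2 :
  frechet_le s t r1 -> frechet_le t u r2 -> frechet_le s u (r1 + r2).
Proof.
case=> h rh hP [g rg gP]; exists (h \o g); first exact: reparam_comp.
move=> x x01 /=; rewrite -[X in eucl_norm X](subrKA (t (g x))).
apply: (le_trans (eucl_normD _ _)); apply: lerD; last exact: gP.
exact/hP/reparam_itv.
Qed.

Lemma frechet_le_weak r s t r' : r <= r' -> frechet_le s t r -> frechet_le s t r'.
Proof. by move=> rr [h rh hP]; exists h => // x /hP /le_trans; exact. Qed.

Let dists s t := [set r | exists a b, [/\ reparametrization a, reparametrization b &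
    r = sup [set eucl_norm (s (a x) - t (b x)) | x in `[0, 1]]]].

Let dists_ge0 s t r : dists s t r -> 0 <= r.
Proof.
case=> a [b [_ _ ->]]; set E := [set _ | _ in _].
(* The supremum of an unbounded set is 0 by convention. *)
have [Eb|Eb] := pselect (has_ubound E); last first.
  by rewrite sup_out // => -[].
apply: (@le_trans _ _ (eucl_norm (s (a 0) - t (b 0)))).
  exact: eucl_norm_ge0.
by apply: ub_le_sup => //; exists 0 => //=; rewrite bound_itvE.
Qed.

Lemma frechet_dist_ge0 s t : 0 <= frechet_dist s t.
Proof.
apply: lb_le_inf; last by move=> r; exact: dists_ge0.
by eexists; exists idfun, idfun; split; [exact: reparam_id|exact: reparam_id|].
Qed.

Lemma frechet_dist_le s t r : frechet_le s t r -> frechet_dist s t <= r.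
Proof.
case=> h rh hP.
set E := [set eucl_norm (s (h x) - t (idfun x)) | x in `[0, 1]].
apply: (@le_trans _ _ (sup E)).
  apply: ge_inf; first by exists 0 => r'; exact: dists_ge0.
  by exists h, idfun; split => //; exact: reparam_id.
apply: ge_sup; last by move=> _ [x x01 <-]; exact: hP.
by eexists; exists 0 => //=; rewrite bound_itvE.
Qed.

Definition bounded_curve s := exists M, forall x, x \in `[0, 1] -> eucl_norm (s x) <= M.

(** The inequality is strict because the infimum over matchings need not be attained. Boundedness
    makes the supremum a genuine upper bound instead of the default value 0. *)
Lemma frechet_le_of_dist s t r : bounded_curve s -> bounded_curve t ->
  frechet_dist s t < r -> frechet_le s t r.
Proof.
move=> [M sM] [M' tM] str.
have [||e [a [b [ra rb ->]]]] := @inf_adherent R (dists s t) (r - frechet_dist s t).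
- by rewrite subr_gt0.
- split; last by exists 0 => r'; exact: dists_ge0.
  by eexists; exists idfun, idfun; split; [exact: reparam_id|exact: reparam_id|].
rewrite -/(frechet_dist s t) addrC subrK => hr.
have [g rg bg] := reparam_inv rb.
exists (a \o g); first exact: reparam_comp.
move=> x x01; apply: le_trans (ltW hr); apply: ub_le_sup.
  exists (M + M') => _ [y /= y01 <-].
  apply: (le_trans (eucl_normD _ _)); rewrite eucl_normN.
  by rewrite lerD // ?sM ?tM ?reparam_itv.
by exists (g x); rewrite ?bg //; exact: reparam_itv.
Qed.

End FrechetLe.

Section PlCurves.
Variables (R : realType) (d : nat).
Implicit Types (tau : plcurve R d).

(** The knots [q], [q'] and the coefficient [a] do not depend on [G]: curves visiting different
    vertices at the same instants can thus be compared pointwise. *)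
Lemma interp_conv (p : R * 'rV[R]_d) s t :
  path <%R p.1 (unzip1 s) -> p.1 <= t <= last p.1 (unzip1 s) ->
  exists q q' a, [/\ q \in p :: s, q' \in p :: s, 0 <= a <= 1 &
    forall d' (G : R * 'rV[R]_d -> 'rV[R]_d'),
      interp (p.1, G p) [seq (z.1, G z) | z <- s] t = (1 - a) *: G q + a *: G q'].
Proof.
elim: s p => [|q s IH] p /=.
  move=> _ _; exists p, p, 0; rewrite !mem_head lexx ler01; split => // d' G.
  by rewrite subr0 scale1r scale0r addr0.
move=> /andP[pq qs] /andP[pt ts]; have [tq|tq] := boolP (t <= q.1).
  exists p, q, ((t - p.1) / (q.1 - p.1)); split.
  - exact: mem_head.
  - by rewrite inE mem_head orbT.
  - have qp : 0 < q.1 - p.1 by rewrite subr_gt0.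
    rewrite divr_ge0 ?subr_ge0 ?(ltW pq) //= ler_pdivrMr // mul1r lerD2r.
    by [].
  - by move=> d' G /=; rewrite scalerBl scale1r scalerBr addrA addrAC.
have [|q1 [q2 [a [q1s q2s a01 H]]]] := IH q qs.
  by rewrite ts andbT ltW // ltNge.
by exists q1, q2, a; split; rewrite // inE ?q1s ?q2s orbT.
Qed.

Lemma path_le_last (x : R) s y : path <%R x s -> y \in x :: s -> y <= last x s.
Proof.
elim: s x y => [|z s IH] x y /=; first by rewrite inE => _ /eqP->.
move=> /andP[xz zs]; rewrite inE => /predU1P[->|]; last exact: IH.
by apply: (le_trans (ltW xz)); apply: IH; rewrite ?mem_head.
Qed.

Lemma interp_knot (p : R * 'rV[R]_d) s q : s != [::] ->
  path <%R p.1 (unzip1 s) -> q \in p :: s -> interp p s q.1 = q.2.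
Proof.
elim: s p => [//|z s IH] p _ /= /andP[pz zs]; rewrite inE => /predU1P[->|].
  by rewrite (ltW pz) subrr mul0r scale0r addr0.
rewrite inE => /predU1P[->|qs].
  by rewrite lexx divff ?scale1r ?subr_eq0 ?gt_eqF // addrC subrK.
have sn : s != [::] by case: (s) qs.
have zq : z.1 < q.1.
  by have /allP/(_ q.1) := order_path_min lt_trans zs; apply; exact: map_f.
by rewrite leNgt zq /=; apply: IH; rewrite // inE qs orbT.
Qed.

Variant knots_spec tau : Prop :=
  KnotsSpec p s of knots tau = p :: s & s != [::] & p.1 = 0 &
    last p.1 (unzip1 s) = 1 & path <%R p.1 (unzip1 s).

Lemma knotsP tau : knots_spec tau.
Proof.
have := knots_sorted tau; have := knots_head tau; have := knots_last tau.
case E : (knots tau) => [|p s] /= /eqP l1 /eqP h0 ps.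
  by move/eqP: l1; rewrite eq_sym oner_eq0.
apply: (KnotsSpec E) => //; apply: contra_eqN l1 => /eqP->.
by rewrite /= h0 eq_sym oner_eq0.
Qed.

Lemma knots_itv tau q : q \in knots tau -> q.1 \in `[0, 1].
Proof.
case: (knotsP tau) => p s -> _ p0 s1 ps qs; rewrite in_itv /= -[X in X <= _]p0 -s1.
apply/andP; split; last by apply: path_le_last => //; exact: (map_f fst qs).
move: qs; rewrite inE => /predU1P[->//|qs]; apply/ltW.
by have /allP/(_ q.1) := order_path_min lt_trans ps; apply; exact: map_f.
Qed.

Lemma plcurve_knot tau q : q \in knots tau -> tau q.1 = q.2.
Proof.
rewrite /plcurve_eval; case: (knotsP tau) => p s -> sn _ _ ps.
exact: interp_knot.
Qed.

Section MapKnots.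
Variables (d' : nat) (G : R * 'rV[R]_d -> 'rV[R]_d') (tau : plcurve R d).

Let fknots := [seq (p.1, G p) | p <- knots tau].

Let fknots1 : unzip1 fknots = unzip1 (knots tau).
Proof. by rewrite /unzip1 -map_comp; apply: eq_map. Qed.

Let fknots_sorted : sorted <%R (unzip1 fknots).
Proof. by rewrite fknots1 knots_sorted. Qed.

Let fknots_head : head 1 (unzip1 fknots) == 0.
Proof. by rewrite fknots1 knots_head. Qed.

Let fknots_last : last 0 (unzip1 fknots) == 1.
Proof. by rewrite fknots1 knots_last. Qed.

(** In contrast to [map_vertices], the new vertex may depend on the instant, so a repeated vertex
    may receive several images. *)
Definition map_knots : plcurve R d' :=
  PLCurve fknots_sorted fknots_head fknots_last.

Lemma complexity_map_knots : complexity map_knots = complexity tau.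
Proof. by rewrite /complexity /vertices /= !size_map. Qed.

End MapKnots.

Lemma map_knots_conv tau t : t \in `[0, 1] ->
  exists q q' a, [/\ q \in knots tau, q' \in knots tau, 0 <= a <= 1 &
    forall d' (G : R * 'rV[R]_d -> 'rV[R]_d'),
      map_knots G tau t = (1 - a) *: G q + a *: G q'].
Proof.
rewrite in_itv /=; rewrite /plcurve_eval /=.
case: (knotsP tau) => p s -> sn p0 s1 ps t01.
by have [|q [q' [a H]]] := interp_conv (t := t) ps; [rewrite s1 p0|exists q, q', a].
Qed.

Lemma map_knots_snd tau t : map_knots snd tau t = tau t.
Proof.
rewrite /plcurve_eval /=.
by have -> : [seq (p.1, p.2) | p <- knots tau] = knots tau;
  [rewrite -[RHS]map_id; apply: eq_map => -[]|].
Qed.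

Lemma bounded_plcurve tau : bounded_curve tau.
Proof.
exists (\sum_(q <- knots tau) eucl_norm q.2) => t t01.
have [q [q' [a [qk qk' a01 H]]]] := map_knots_conv tau t01.
have le_sum z : z \in knots tau ->
    eucl_norm z.2 <= \sum_(q <- knots tau) eucl_norm q.2.
  move=> zk; rewrite (big_rem z) //= lerDl; apply: sumr_ge0 => *.
  exact: eucl_norm_ge0.
by rewrite -(map_knots_snd tau) H; apply: eucl_norm_conv => //; exact: le_sum.
Qed.

End PlCurves.

Lemma map_vertices_eval (R : realType) (d d' : nat) (A : 'M[R]_(d, d'))
    (tau : plcurve R d) (t : R) :
  t \in `[0, 1] -> map_vertices (mulmxr A) tau t = tau t *m A.
Proof.
move=> t01; have [q [q' [a [_ _ _ H]]]] := map_knots_conv tau t01.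
have -> : map_vertices (mulmxr A) tau t = map_knots (mulmxr A \o snd) tau t by [].
by rewrite -(map_knots_snd tau) !H /= mulmxDl !scalemxAl.
Qed.

(* The centre [c] is replaced by the curve with the same instants whose vertices
   are the points of [t] matched with the vertices of [c]. *)
Lemma frechet_simplification (R : realType) (d d' : nat) (t : R -> 'rV[R]_d)
    (t' : R -> 'rV[R]_d') (c : plcurve R d') (L r : R) :
  0 <= L ->
  (forall x x1 x2 a, x \in `[0, 1] -> x1 \in `[0, 1] -> x2 \in `[0, 1] ->
    eucl_norm (t x - ((1 - a) *: t x1 + a *: t x2)) <=
    L * eucl_norm (t' x - ((1 - a) *: t' x1 + a *: t' x2))) ->
  frechet_le t' c r ->
  exists2 s : plcurve R d, complexity s = complexity c & frechet_le t s (L * (2 * r)).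
Proof.
move=> L0 tL [h rh hP].
exists (map_knots (fun q => t (h q.1)) c); first exact: complexity_map_knots.
exists h => // x x01.
have [q [q' [a [qk qk' a01 H]]]] := map_knots_conv c x01.
have q01 := knots_itv qk; have q01' := knots_itv qk'.
rewrite H; apply: (le_trans (tL _ _ _ _ _ _ _)); rewrite ?reparam_itv //.
rewrite ler_wpM2l // -[X in eucl_norm X](subrKA (c x)) mulr2n mulrDl mul1r.
apply: (le_trans (eucl_normD _ _)); apply: lerD; first exact: hP.
(* Both ends of the segment move by at most [r], hence so does its point; with the distance from
   [t'] to [c] this gives [2 * r]. *)
have -> : c x - ((1 - a) *: t' (h q.1) + a *: t' (h q'.1)) =
    (1 - a) *: (c q.1 - t' (h q.1)) + a *: (c q'.1 - t' (h q'.1)).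
  by rewrite !plcurve_knot // -(map_knots_snd c) H !scalerBr opprD addrACA.
by apply: eucl_norm_conv => //; rewrite eucl_normB; exact: hP.
Qed.

(** * Optimal median costs *)

Section GeneralPosition.
Variables (R : realType) (d : nat).
Implicit Types (a b v w : 'rV[R]_d) (r : R).

Lemma eucl_norm_delta (i : 'I_d) : eucl_norm (delta_mx 0 i : 'rV[R]_d) = 1.
Proof.
rewrite eucl_normE /dot (bigD1 i) //= big1 => [|j ji].
  by rewrite !mxE !eqxx mulr1 addr0 sqrtr1.
by rewrite !mxE (negbTE ji) andbF mul0r.
Qed.

(** Pigeonhole on [(size s).+1] distinct points of a short segment starting near [v]. *)
Lemma exists_near_avoiding v r (s : seq 'rV[R]_d) : (0 < d)%N -> 0 < r ->
  exists2 w, eucl_norm (w - v) <= r & w \notin s.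
Proof.
move=> d0 r0; pose e : 'rV[R]_d := delta_mx 0 (Ordinal d0).
pose f i := v + (r / i.+1%:R) *: e.
have finj : injective f.
  move=> i j /addrI /eqP; rewrite -subr_eq0 -scalerBl scaler_eq0 subr_eq0.
  rewrite -eucl_norm_eq0 eucl_norm_delta oner_eq0 orbF => /eqP.
  move/(mulfI (lt0r_neq0 r0))/invr_inj/eqP; rewrite eqr_nat => /eqP.
  by case.
have : ~~ all (mem s) (mkseq f (size s).+1).
  apply/negP => /allP fs.
  have := uniq_leq_size (mkseq_uniq _ finj) fs.
  by rewrite size_mkseq ltnn.
case/allPn => _ /mapP[i _ ->] fi; exists (f i) => //.
rewrite /f addrC addKr eucl_normZ eucl_norm_delta mulr1 ger0_norm.
  by rewrite ler_pdivrMr // ler_peMr ?ler1n // ltW.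
by rewrite divr_ge0 // ltW.
Qed.

(** If [c] lies on the line, it is moved along a coordinate axis; two distinct axes cannot both be
    parallel to [b - a]. *)
Lemma exists_near_off_line a b (c : 'rV[R]_d) r : (1 < d)%N -> 0 < r -> a != b ->
  exists2 w, eucl_norm (w - c) <= r & forall x : R, w <> a + x *: (b - a).
Proof.
move=> d1 r0 ab.
have [[x cx]|cl] := pselect (exists x : R, c = a + x *: (b - a)); last first.
  exists c; first by rewrite subrr eucl_norm0 ltW.
  by move=> x cx; apply: cl; exists x.
have [i hi] : exists i : 'I_d, forall x : R, delta_mx 0 i <> x *: (b - a).
  pose i0 := Ordinal (ltnW d1); pose i1 := Ordinal d1.
  have [[y hy]|h] := pselect (exists y : R, delta_mx 0 i0 = y *: (b - a)).
    exists i1 => z hz.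
    move/rowP: (hy) => /(_ i0); move/rowP: (hy) => /(_ i1); move/rowP: hz => /(_ i1).
    rewrite !mxE !eqxx /= => h1 /eqP; rewrite eq_sym mulf_eq0 => /orP[/eqP->|/eqP h2].
      by rewrite mul0r => /eqP; rewrite oner_eq0.
    by move: h1; rewrite h2 mulr0 => /eqP; rewrite oner_eq0.
  by exists i0 => x' hx; apply: h; exists x'.
exists (c + r *: delta_mx 0 i).
  by rewrite addrC addKr eucl_normZ eucl_norm_delta mulr1 ger0_norm // ltW.
move=> y; rewrite cx -addrA => /addrI => h.
apply: (hi (r^-1 * (y - x))).
have -> : delta_mx 0 i = r^-1 *: (r *: delta_mx 0 i) :> 'rV[R]_d.
  by rewrite scalerA mulVf ?scale1r // gt_eqF.
by rewrite -scalerA; congr (_ *: _); rewrite scalerBl -h addrC addrK.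
Qed.

Lemma general_position (v : nat -> 'rV[R]_d) r (s : seq 'rV[R]_d) :
  (1 < d)%N -> 0 < r ->
  exists w : nat -> 'rV[R]_d, [/\ forall i, eucl_norm (w i - v i) <= r,
    w 0%N \notin s, forall i, w i != w i.+1 &
    forall i (x : R), w i.+2 <> w i + x *: (w i.+1 - w i)].
Proof.
move=> d1 r0; have d0 := ltnW d1.
have [w0 w0r w0s] := exists_near_avoiding (v 0%N) s d0 r0.
have [w1 w1r] := exists_near_avoiding (v 1%N) [:: w0] d0 r0.
rewrite inE eq_sym => w01.
have /choice[f fP] (q : 'rV[R]_d * 'rV[R]_d * 'rV[R]_d) :
    exists w, q.1.1 != q.1.2 -> eucl_norm (w - q.2) <= r /\
      forall x : R, w <> q.1.1 + x *: (q.1.2 - q.1.1).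
  have [ab|ab] := boolP (q.1.1 != q.1.2); last by exists 0.
  by have [w ? ?] := exists_near_off_line q.2 d1 r0 ab; exists w.
(* The state holds two consecutive points, since each new point must avoid the line through the
   preceding two. *)
pose st := fix st i := if i is j.+1 then
  ((st j).2, f ((st j).1, (st j).2, v j.+2)) else (w0, w1).
have stS i : (st i.+1).1 = (st i).2 by [].
have stn i : (st i).1 != (st i).2.
  elim: i => [//|i IH] /=; have [_] := fP ((st i).1, (st i).2, v i.+2) IH.
  move=> /(_ 1) /= /eqP; rewrite scale1r addrC subrK.
  by rewrite eq_sym.
exists (fun i => (st i).1); split => //.
  move=> [|[|i]] //=.
  by have [] := fP ((st i).1, (st i).2, v i.+2) (stn i).
by move=> i x; have [_] := fP ((st i).1, (st i).2, v i.+2) (stn i); apply.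
Qed.

(** [L] will list the starting points of the centres already chosen, so that avoiding it makes the
    new curve distinct from them. *)
Lemma polygonal_approx (s : plcurve R d) r (L : seq 'rV[R]_d) :
  (1 < d)%N -> 0 < r ->
  exists c : plcurve R d, [/\ polygonal c, complexity c = complexity s,
    frechet_le s c r & c 0 \notin L].
Proof.
move=> d1 r0.
have [w [wr wL wn wl]] := general_position (fun i => (vertices s)`_i) L d1 r0.
(* The instants increase strictly, so the knots are distinct and the index recovers the position. *)
pose G q := w (index q (knots s)).
have ku : uniq (knots s).
  exact/(@map_uniq _ _ fst)/(sorted_uniq lt_trans ltxx (knots_sorted s)).
have vE i : (i < complexity s)%N -> (vertices (map_knots G s))`_i = w i.
  rewrite /complexity size_map => ik; rewrite /vertices /= /unzip2 -map_comp.
  by rewrite (nth_map (0, 0)) //= /G index_uniq.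
exists (map_knots G s); split.
- move=> i; rewrite complexity_map_knots => ik [p [e [_ pe]]].
  have [|x0 _ h0] := pe (w i); first by rewrite -vE ?(ltnW (ltnW ik)); [left; left|].
  have [|x1 _ h1] := pe (w i.+1).
    by rewrite -(vE i.+1) ?(ltnW ik) //; left; right.
  have [|x2 _ h2] := pe (w i.+2); first by rewrite -(vE i.+2) //; right.
  have x01 : x1 - x0 != 0.
    rewrite subr_eq0; apply: contra (wn i) => /eqP x01.
    by rewrite -h0 -h1 x01.
  apply: (wl i ((x2 - x0) / (x1 - x0))); rewrite -h0 -h1 -h2.
  rewrite opprD addrACA subrr add0r -scalerBl scalerA divfK // scalerBl.
  by rewrite addrA addrAC addrK.
- exact: complexity_map_knots.
- exists idfun; first exact: reparam_id.
  move=> x x01; have [q [q' [a [qk qk' a01 H]]]] := map_knots_conv s x01.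
  rewrite -(map_knots_snd s) !H opprD addrACA -!scalerBr.
  have near z : z \in knots s -> eucl_norm (z.2 - G z) <= r.
    move=> zk; rewrite eucl_normB; apply: le_trans (wr (index z (knots s))).
    by rewrite (nth_map (0, 0)) ?index_mem // nth_index.
  by apply: eucl_norm_conv => //; exact: near.
- suff -> : map_knots G s 0 = w 0%N by [].
  have [p k kE kn p0 _ _] := knotsP s.
  rewrite -p0; have := @plcurve_knot _ _ (map_knots G s) (p.1, G p).
  by rewrite /= kE mem_head /= => /(_ isT) ->; rewrite /G kE /= eqxx.
Qed.

Lemma median_candidate_approx (k l : nat) (g : 'I_k -> plcurve R d) r :
  (1 < d)%N -> (0 < k)%N -> 0 < r -> (forall j, (complexity (g j) <= l)%N) ->
  exists2 C, median_candidate k l C & forall j, exists2 c, C c & frechet_le (g j) c r.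
Proof.
move=> d1 k0 r0 gl; pose g' j := g (insubd (Ordinal k0) j).
have [c [cP ci]] : exists c : nat -> plcurve R d,
    (forall j, (j < k)%N -> [/\ polygonal (c j), (complexity (c j) <= l)%N &
      frechet_le (g' j) (c j) r]) /\
    (forall i j, (i < j < k)%N -> c i 0 != c j 0).
  elim: {1 2}k => [|m [c [cP ci]]]; first by exists g'; split => [|i j] //; rewrite andbF.
  have [c' [c'p c'l c'r c'L]] :=
    polygonal_approx (g' m) [seq c i 0 | i <- iota 0 m] d1 r0.
  exists (fun j => if j == m then c' else c j); split => [j|i j].
    rewrite ltnS leq_eqVlt => /predU1P[->|jm]; last by rewrite ltn_eqF //; exact: cP.
    by rewrite eqxx c'l; split => //; exact: gl.
  rewrite ltnS [(j <= m)%N]leq_eqVlt => /andP[ij /predU1P[jm|jm]].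
    rewrite jm eqxx in ij *; rewrite ltn_eqF //; apply: contra c'L => /eqP <-.
    by apply/mapP; exists i; rewrite // mem_iota.
  by rewrite !ltn_eqF ?(ltn_trans ij) //; apply: ci; rewrite ij.
exists (c @` `I_k).
  split; last by move=> _ [j /= jk <-]; have [] := cP j jk.
  apply: inj_card_eq => i j; rewrite !inE /= => ik jk cij.
  case: (ltngtP i j) => // h.
    by have := ci i j; rewrite h jk cij eqxx => /(_ isT).
  by have := ci j i; rewrite h ik cij eqxx => /(_ isT).
move=> j; have [_ _ h] := cP j (ltn_ord j).
by exists (c j); [exists (j : nat) => //=|move: h; rewrite /g' valKd].
Qed.

Lemma median_cost_ge0 (n : nat) (T : 'I_n -> plcurve R d) C : 0 <= median_cost T C.
Proof.
apply: sumr_ge0 => i _; set E := [set _ | _ in _].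
have [->|E0] := eqVneq E set0; first by rewrite inf0.
apply: lb_le_inf; first exact/set0P.
by move=> _ [c _ <-]; exact: frechet_dist_ge0.
Qed.

Lemma median_opt_ge0 (k l n : nat) (T : 'I_n -> plcurve R d) : 0 <= median_opt k l T.
Proof.
rewrite /median_opt; set E := [set _ | _ in _].
have [->|E0] := eqVneq E set0; first by rewrite inf0.
apply: lb_le_inf; first exact/set0P.
by move=> _ [c _ <-]; exact: median_cost_ge0.
Qed.

(** The centres [g] may coincide or have collinear consecutive vertices: an arbitrarily small
    perturbation makes them a candidate, and the optimum is an infimum. *)
Lemma median_opt_le (k l n : nat) (T : 'I_n -> plcurve R d)
    (g : 'I_k -> plcurve R d) (B : 'I_n -> R) :
  (1 < d)%N -> (0 < k)%N -> (forall j, (complexity (g j) <= l)%N) ->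
  (forall i, exists j, frechet_le (T i) (g j) (B i)) ->
  median_opt k l T <= \sum_i B i.
Proof.
move=> d1 k0 gl TB; apply/ler_addgt0Pr => r r0.
pose r' := r / n.+1%:R; have r'0 : 0 < r' by rewrite divr_gt0.
have [C Cc CP] := median_candidate_approx d1 k0 r'0 gl.
apply: (@le_trans _ _ (median_cost T C)).
  apply: ge_inf; last by exists C.
  by exists 0 => _ [c _ <-]; exact: median_cost_ge0.
apply: (@le_trans _ _ (\sum_i (B i + r'))).
  apply: ler_sum => i _; have [j Tj] := TB i; have [c Cc' gc] := CP j.
  apply: le_trans (frechet_dist_le (frechet_le_trans Tj gc)).
  apply: ge_inf; last by exists c.
  by exists 0 => _ [c' _ <-]; exact: frechet_dist_ge0.
rewrite big_split /= lerD2l sumr_const card_ord -[leLHS]mulr_natr /r'.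
by rewrite mulrAC ler_pdivrMr // ler_wpM2l ?ler_nat // ltW.
Qed.

Lemma median_candidate_enum (k l : nat) C : median_candidate k l C ->
  exists g : 'I_k -> plcurve R d, (forall j, C (g j)) /\
    (forall c, C c -> exists j, g j = c).
Proof.
case=> /card_set_bijP[f [ff fi fs]] _.
have /choice[g gP] (j : 'I_k) : exists c, C c /\ f c = j.
  by have [c Cc fc] := fs j (ltn_ord j); exists c.
exists g; split => [j|c Cc]; first by have [] := gP j.
exists (Ordinal (ff c Cc)); have [Cg fg] := gP (Ordinal (ff c Cc)).
by apply: fi; rewrite ?inE.
Qed.

Lemma median_candidate_exists (k l : nat) : (1 < d)%N -> (0 < k)%N -> (1 < l)%N ->
  exists C, @median_candidate R d k l C.
Proof.
move=> d1 k0 l1.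
pose K : seq (R * 'rV[R]_d) := [:: (0, 0); (1, 0)].
have Ks : sorted <%R (unzip1 K) by rewrite /= ltr01.
have Kh : head 1 (unzip1 K) == 0 by [].
have Kl : last 0 (unzip1 K) == 1 by [].
have [C CP _] := @median_candidate_approx k l (fun=> PLCurve Ks Kh Kl) 1 d1 k0 ltr01
  (fun=> l1).
by exists C.
Qed.

Lemma median_near_center (k n : nat) (T : 'I_n -> plcurve R d) C
    (g : 'I_k -> plcurve R d) i r :
  (0 < k)%N -> (forall j, C (g j)) -> (forall c, C c -> exists j, g j = c) -> 0 < r ->
  exists j, frechet_dist (T i) (g j) < inf [set frechet_dist (T i) c | c in C] + r.
Proof.
move=> k0 gC Cg r0.
have [|_ [c /Cg[j <-] <-] h] := @inf_adherent R [set frechet_dist (T i) c | c in C] r r0.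
  split; first by eexists; exists (g (Ordinal k0)).
  by exists 0 => _ [c _ <-]; exact: frechet_dist_ge0.
by exists j.
Qed.

End GeneralPosition.

(** * Comparison of optimal costs in two spaces *)

Section Transfer.
Variables (R : realType) (d d' k l n : nat).
Variables (T : 'I_n -> plcurve R d) (T' : 'I_n -> plcurve R d').
Variables (L : R).
Hypotheses (d1 : (1 < d)%N) (k0 : (0 < k)%N) (L0 : 0 < L).

(** The pointwise bound lets the matching of [T' i] with a nearby centre [g' j] serve for [T i] and
    [g j] as well. *)
Lemma median_opt_le_image (C' : set (plcurve R d'))
    (g : 'I_k -> plcurve R d) (g' : 'I_k -> plcurve R d') :
  (forall j, C' (g' j)) -> (forall c, C' c -> exists j, g' j = c) ->
  (forall j, (complexity (g j) <= l)%N) ->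
  (forall i j x y, x \in `[0, 1] -> y \in `[0, 1] ->
    eucl_norm (T i x - g j y) <= L * eucl_norm (T' i x - g' j y)) ->
  median_opt k l T <= L * median_cost T' C'.
Proof.
move=> gC Cg gl TL; apply/ler_addgt0Pr => r r0.
pose r' := r / (L * n.+1%:R).
have r'0 : 0 < r' by rewrite divr_gt0 ?mulr_gt0.
apply: (@le_trans _ _ (\sum_i (L * (inf [set frechet_dist (T' i) c | c in C'] + r')))).
  apply: (median_opt_le d1 k0 gl) => i.
  have [j] := median_near_center T' i k0 gC Cg r'0.
  case/(frechet_le_of_dist (bounded_plcurve _) (bounded_plcurve _)) => h rh hP.
  exists j, h => // x x01; apply: (le_trans (TL _ _ _ _ _ _)) => //.
    exact: reparam_itv.
  by rewrite ler_wpM2l ?hP // ltW.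
rewrite -mulr_sumr big_split /= mulrDr lerD2l sumr_const card_ord -[_ *+ n]mulr_natr.
rewrite mulrA /r' invfM !mulrA [L * r]mulrC mulfK ?gt_eqF //.
by rewrite mulrAC ler_pdivrMr // ler_wpM2l ?ler_nat // ltW.
Qed.

(* Each centre is replaced by a simplification of the input curve closest to it:
   reaching that curve costs a factor 2, and so does simplifying it. *)
Lemma median_opt_transfer :
  (1 < d')%N -> (1 < l)%N -> (0 < n)%N ->
  (forall i j x y, x \in `[0, 1] -> y \in `[0, 1] ->
    eucl_norm (T i x - T j y) <= L * eucl_norm (T' i x - T' j y)) ->
  (forall i x x1 x2 a, x \in `[0, 1] -> x1 \in `[0, 1] -> x2 \in `[0, 1] ->
    eucl_norm (T i x - ((1 - a) *: T i x1 + a *: T i x2)) <=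
    L * eucl_norm (T' i x - ((1 - a) *: T' i x1 + a *: T' i x2))) ->
  median_opt k l T <= 4 * L * median_opt k l T'.
Proof.
move=> d'1 l1 n0 TL TL2.
have L40 : 0 < 4 * L by rewrite mulr_gt0.
rewrite -ler_pdivrMl //; apply: lb_le_inf.
  by have [C CP] := @median_candidate_exists R d' k l d'1 k0 l1; exists (median_cost T' C), C.
move=> _ [C' [Cc Cl] <-]; rewrite ler_pdivrMl //.
have [g [gC Cg]] := median_candidate_enum (conj Cc Cl).
apply/ler_addgt0Pr => r r0.
pose r' := r / (4 * L * n.+1%:R).
have r'0 : 0 < r' by rewrite divr_gt0 ?mulr_gt0.
pose I i := inf [set frechet_dist (T' i) c | c in C'].
pose near j := [arg min_(i < Ordinal n0) frechet_dist (T' i) (g j)]%O.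
have nearP i j : frechet_dist (T' (near j)) (g j) <= frechet_dist (T' i) (g j).
  by rewrite /near; case: arg_minP => // i' _; apply.
(* The slack [r' / 2] turns distances into actual matchings. *)
pose rho j := frechet_dist (T' (near j)) (g j) + r' / 2.
have close j i : frechet_dist (T' i) (g j) < I i + r' / 2 -> rho j <= I i + r'.
  by move=> h; have := nearP i j; rewrite /rho; lra.
have /choice[s sP] j : exists s : plcurve R d, complexity s = complexity (g j) /\
    frechet_le (T (near j)) s (L * (2 * rho j)).
  have h : frechet_le (T' (near j)) (g j) (rho j).
    apply: (frechet_le_of_dist (bounded_plcurve _) (bounded_plcurve _)).
    by rewrite /rho ltrDl divr_gt0.
  by have [s ? ?] := frechet_simplification (ltW L0) (TL2 (near j)) h; exists s.
apply: (@le_trans _ _ (\sum_i (4 * L * (I i + r')))).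
  apply: (@median_opt_le R d k l n T s) => // [j|i].
    by have [-> _] := sP j; have [_] := Cl _ (gC j).
  have [|j hj] := @median_near_center R d' k n T' C' g i (r' / 2) k0 gC Cg.
    by rewrite divr_gt0.
  exists j; have hr := close j i hj.
  have [_ sj] := sP j.
  (* Two input curves are matched through [g j] in the other space, and only then is the matching
     carried over. This and the simplification each cost [2 * L]. *)
  have Tij : frechet_le (T i) (T (near j)) (L * (2 * (I i + r'))).
    have [h rh hP] : frechet_le (T' i) (T' (near j)) (2 * (I i + r')).
      rewrite mulr2n mulrDl mul1r; apply: (@frechet_le_trans _ _ (g j)).
        apply: (frechet_le_of_dist (bounded_plcurve _) (bounded_plcurve _)).
        by apply: lt_trans hj _; lra.
      apply: frechet_le_sym.
      apply: (frechet_le_of_dist (bounded_plcurve _) (bounded_plcurve _)).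
      by move: hr; rewrite /rho; lra.
    exists h => // x x01; apply: (le_trans (TL _ _ _ _ _ x01)).
      exact: reparam_itv.
    by rewrite ler_wpM2l ?hP // ltW.
  apply: frechet_le_weak (frechet_le_trans Tij sj).
  by have := ler_wpM2l (ltW L0) hr; lra.
rewrite -mulr_sumr big_split /= mulrDr lerD2l sumr_const card_ord -[_ *+ n]mulr_natr.
rewrite mulrA /r' invfM !mulrA [4 * L * r]mulrC mulfK ?gt_eqF //.
by rewrite mulrAC ler_pdivrMr // ler_wpM2l ?ler_nat // ltW.
Qed.

End Transfer.

Lemma plcurve_ext (R : realType) (d : nat) (s t : plcurve R d) :
  knots s = knots t -> s = t.
Proof.
case: s t => [ks s1 s2 s3] [kt t1 t2 t3] /= E; move: s1 s2 s3; rewrite E => *.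
by congr PLCurve; exact: bool_irrelevance.
Qed.

Lemma map_vertices1 (R : realType) (d : nat) (t : plcurve R d) :
  map_vertices (mulmxr 1%:M) t = t.
Proof.
apply: plcurve_ext => /=; rewrite -[RHS]map_id.
by apply: eq_map => -[x v] /=; rewrite mulmx1.
Qed.

Lemma measurable_singleton (R : realType) (d d' : nat) (A : borel_matrix R d d') :
  measurable [set A].
Proof.
rewrite -[X in measurable X]setCK; apply: measurableC; apply: sub_sigma_algebra.
apply: closed_openC; apply: accessible_closed_set1; apply: hausdorff_accessible.
exact: (@norm_hausdorff _ 'M[R]_(d, d')).
Qed.

(** * Near-isometries and median costs *)

Section NearIsometry.
Variables (R : realType) (d N : nat) (A : 'M[R]_(d, N)) (J : finType).
Variables (pt : J -> 'rV[R]_d) (e : R).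
Hypotheses (e01 : 0 < e < 1)
  (ptA : forall (j : 'I_6 -> J) (u : 'I_6 -> R),
    let v := \sum_a u a *: pt (j a) in
    `|dot (v *m A) (v *m A) - dot v v| <= e / 2 * dot v v).

Definition through_points (t : plcurve R d) : Prop :=
  forall q, q \in knots t -> exists j, q.2 = pt j.

Lemma through_points_conv t x : through_points t -> x \in `[0, 1] ->
  exists j j' a, t x = (1 - a) *: pt j + a *: pt j'.
Proof.
move=> tp x01; have [q [q' [a [qk qk' _ H]]]] := map_knots_conv t x01.
have [[j qj] [j' qj']] := (tp q qk, tp q' qk').
by exists j, j', a; rewrite -map_knots_snd H qj qj'.
Qed.

(** After squaring, these follow from (1 + e/4)^2 >= 1 + e/2 and from 9/4 * (1 - e/2) >= 1, the
    latter because [e < 1]. *)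
Lemma near_isometry_norm v : `|dot (v *m A) (v *m A) - dot v v| <= e / 2 * dot v v ->
  eucl_norm (v *m A) <= (1 + e / 4) * eucl_norm v /\
  eucl_norm v <= 3 / 2 * eucl_norm (v *m A).
Proof.
rewrite -!eucl_norm_sqr ler_norml.
move: (eucl_norm_ge0 v) (eucl_norm_ge0 (v *m A)) e01.
set x := eucl_norm v; set y := eucl_norm _ => x0 y0 /andP[e0 e1] /andP[h1 h2].
have x2 : 0 <= x ^+ 2 by apply: sqr_ge0.
have ex : e * x ^+ 2 <= x ^+ 2 by rewrite ler_piMl // ltW.
have ex' : 0 <= e ^+ 2 * x ^+ 2 by rewrite mulr_ge0 ?sqr_ge0.
have y2 : 0 <= y ^+ 2 by apply: sqr_ge0.
have c1 : 0 <= (1 + e / 4) * x by rewrite mulr_ge0 //; lra.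
have c2 : 0 <= 3 / 2 * y by rewrite mulr_ge0 //; lra.
have s1 : (1 + e / 4) ^+ 2 = 1 + e / 2 + e ^+ 2 / 16 by field.
have s2 : (3 / 2) ^+ 2 = 9 / 4 :> R by field.
by split; rewrite -ler_sqr ?nnegrE // exprMn ?s1 ?s2; lra.
Qed.

Lemma near_isometry_curves3 t1 t2 t3 x1 x2 x3 a :
  through_points t1 -> through_points t2 -> through_points t3 ->
  x1 \in `[0, 1] -> x2 \in `[0, 1] -> x3 \in `[0, 1] ->
  let v := t1 x1 - ((1 - a) *: t2 x2 + a *: t3 x3) in
  eucl_norm (v *m A) <= (1 + e / 4) * eucl_norm v /\
  eucl_norm v <= 3 / 2 * eucl_norm (v *m A).
Proof.
move=> p1 p2 p3 x1i x2i x3i v; apply: near_isometry_norm.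
have [j1 [j1' [a1 E1]]] := through_points_conv p1 x1i.
have [j2 [j2' [a2 E2]]] := through_points_conv p2 x2i.
have [j3 [j3' [a3 E3]]] := through_points_conv p3 x3i.
(* Each of the three curve points is a combination of two vertices, which accounts for the six
   points in the hypothesis. *)
pose j (i : 'I_6) := nth j1 [:: j1; j1'; j2; j2'; j3; j3'] i.
pose u (i : 'I_6) := nth 0 [:: 1 - a1; a1; - ((1 - a) * (1 - a2)); - ((1 - a) * a2);
                               - (a * (1 - a3)); - (a * a3)] i.
have -> : v = \sum_i u i *: pt (j i); last exact: ptA.
rewrite !big_ord_recl big_ord0 /= addr0 /v E1 E2 E3.
by rewrite !scalerDr !scalerA !scaleNr !opprD !addrA.
Qed.

Lemma near_isometry_curves2 t1 t2 x1 x2 :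
  through_points t1 -> through_points t2 -> x1 \in `[0, 1] -> x2 \in `[0, 1] ->
  eucl_norm ((t1 x1 - t2 x2) *m A) <= (1 + e / 4) * eucl_norm (t1 x1 - t2 x2) /\
  eucl_norm (t1 x1 - t2 x2) <= 3 / 2 * eucl_norm ((t1 x1 - t2 x2) *m A).
Proof.
move=> p1 p2 x1i x2i; have := near_isometry_curves3 0 p1 p2 p2 x1i x2i x2i.
by rewrite /= subr0 scale1r scale0r addr0.
Qed.

Lemma near_isometry_median (k l n : nat) (T : 'I_n -> plcurve R d)
    (C : set (plcurve R d)) (g : 'I_k -> plcurve R d) :
  (1 < d)%N -> (1 < N)%N -> (0 < k)%N -> (1 < l)%N -> (0 < n)%N ->
  (forall j, C (g j)) -> (forall c, C c -> exists j, g j = c) ->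
  (forall j, (complexity (g j) <= l)%N) ->
  (forall i, through_points (T i)) -> (forall j, through_points (g j)) ->
  let FT := fun i => map_vertices (mulmxr A) (T i) in
  [/\ median_opt k l T <= 6 * median_opt k l FT,
      median_opt k l FT <= (4 + e) * median_opt k l T &
      median_opt k l FT <= (1 + e / 4) * median_cost T C].
Proof.
move=> d1 N1 k0 l1 n0 gC Cg gl Tp gp FT.
have FTE i x : x \in `[0, 1] -> FT i x = T i x *m A by exact: map_vertices_eval.
have e0 : 0 < e by case/andP: e01.
have conv a u v w : u *m A - ((1 - a) *: (v *m A) + a *: (w *m A)) =
    (u - ((1 - a) *: v + a *: w)) *m A.
  by rewrite !scalemxAl -mulmxDl -mulmxBl.
have c0 : 0 < 1 + e / 4 by lra.
split.
- have -> : 6 = 4 * (3 / 2) :> R by field.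
  apply: (median_opt_transfer d1) => //.
    move=> i j x y x01 y01; rewrite !FTE // -mulmxBl.
    by have [] := near_isometry_curves2 (Tp i) (Tp j) x01 y01.
  move=> i x x1 x2 a x01 x11 x21; rewrite !FTE // conv.
  by have [] := near_isometry_curves3 a (Tp i) (Tp i) (Tp i) x01 x11 x21.
- have -> : 4 + e = 4 * (1 + e / 4) by field.
  apply: (median_opt_transfer N1) => //.
    move=> i j x y x01 y01; rewrite !FTE // -mulmxBl.
    by have [] := near_isometry_curves2 (Tp i) (Tp j) x01 y01.
  move=> i x x1 x2 a x01 x11 x21; rewrite !FTE // conv.
  by have [] := near_isometry_curves3 a (Tp i) (Tp i) (Tp i) x01 x11 x21.
- apply: (@median_opt_le_image _ _ _ _ _ _ _ _ _ N1 k0 c0 C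
    (fun j => map_vertices (mulmxr A) (g j)) g) => // [j|i j x y x01 y01].
    by rewrite /complexity /vertices /= !size_map -(size_map snd); exact: gl.
  rewrite FTE // map_vertices_eval // -mulmxBl.
  by have [] := near_isometry_curves2 (Tp i) (gp j) x01 y01.
Qed.

End NearIsometry.

Lemma through_points_nth (R : realType) (d p : nat) (J : finType)
    (pt : J -> 'rV[R]_d) (f : 'I_p -> J) (t : plcurve R d) :
  (complexity t <= p)%N -> (forall a, pt (f a) = (vertices t)`_a) ->
  through_points pt t.
Proof.
move=> tp ptf q qk.
have iq : (index q (knots t) < p)%N.
  by apply: leq_trans tp; rewrite /complexity size_map index_mem.
exists (f (Ordinal iq)).
by rewrite ptf (nth_map (0, 0)) ?index_mem //= nth_index.
Qed.

(** An infimum is approximated within a multiplicative factor only if it is positive; at 0 any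
    candidate will do. *)
Lemma near_optimal_candidate (R : realType) (d k l n : nat)
    (T : 'I_n -> plcurve R d) (e : R) :
  (1 < d)%N -> (0 < k)%N -> (1 < l)%N -> 0 < e ->
  exists2 C, median_candidate k l C &
    0 < median_opt k l T -> median_cost T C <= (1 + e) * median_opt k l T.
Proof.
move=> d1 k0 l1 e0; have [C0 C0P] := @median_candidate_exists R d k l d1 k0 l1.
have [r0|] := ltrP 0 (median_opt k l T); last by exists C0.
have [||_ [C CP <-] h] := @inf_adherent R
    [set median_cost T C | C in @median_candidate R d k l] (e * median_opt k l T).
- by rewrite mulr_gt0.
- split; first by exists (median_cost T C0), C0.
  by exists 0 => _ [C _ <-]; exact: median_cost_ge0.
by exists C => // _; rewrite mulrDl mul1r ltW.
Qed.

(** * Choice of the target dimension *)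

Lemma ln_ge_half (R : realType) (x : R) : 2 <= x -> 1 / 2 <= ln x.
Proof.
move=> x2; rewrite -ler_expR lnK ?posrE; last by lra.
apply: le_trans x2; have h := expR_ge1Dx (- (1 / 2) : R).
have := expRxMexpNx_1 (1 / 2 : R); have := expR_gt0 (1 / 2 : R); nra.
Qed.

(* [64 * 600 = (200 / 3) * 24 ^ 2] is kept as a product, since numerals are
   unary. *)
Lemma dimension_suffices (R : realType) (k n m l N : nat) (e : R) :
  (0 < k)%N -> (0 < n)%N -> (1 < l)%N -> (l < m)%N -> 0 < e ->
  (64 * 600) * (13 + 6 * k)%:R * (e ^- 2 * ln (n * m)%:R) < N%:R ->
  2 * (#|{: 'I_n * 'I_m + 'I_k * 'I_l}| ^ 6 * (6 * 6))%:R *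
    expR (- (3 / 200 * (e / 2 / (2 * 6)) ^+ 2 * N%:R)) < 1.
Proof.
move=> k0 n0 l1 lm e0 hN; set x := (n * m)%N.
have x2 : (2 <= x)%N by rewrite (leq_trans (ltnW (leq_ltn_trans l1 lm))) // leq_pmull.
have x0 : 0 < x%:R :> R by rewrite ltr0n ltnW.
(* As [l < m], the number of points is at most [k.+1 * x], and [k.+1 <= 2 ^ k <= x ^ k]. *)
have card_le : (#|{: 'I_n * 'I_m + 'I_k * 'I_l}| <= x ^ k.+1)%N.
  rewrite card_sum !card_prod !card_ord -/x.
  apply: (@leq_trans (k.+1 * x)).
    rewrite mulSn leq_add2l leq_mul2l /x -[l]mul1n leq_mul ?orbT //.
    exact: ltnW.
  rewrite expnSr leq_mul2r; apply/orP; right.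
  by apply: leq_trans (ltn_expl k (isT : 1 < 2)%N) _; rewrite leq_exp2r.
(* The exponent is [6 * k.+1 + 7], since 2 * 36 <= 2^7 <= [x ^ 7]. *)
have pow_le : (2 * (#|{: 'I_n * 'I_m + 'I_k * 'I_l}| ^ 6 * (6 * 6)) <= x ^ (13 + 6 * k))%N.
  rewrite mulnCA; apply: (@leq_trans ((x ^ k.+1) ^ 6 * x ^ 7)).
    apply: leq_mul; first by rewrite leq_exp2r.
    by apply: (@leq_trans (2 ^ 7)) => //; rewrite leq_exp2r.
  by rewrite -expnM -expnD leq_exp2l // mulSn mulnC addnAC.
apply: (@le_lt_trans _ _ (expR ((13 + 6 * k)%:R * ln x%:R - e ^+ 2 / (64 * 600) * N%:R))).
  have -> : 3 / 200 * (e / 2 / (2 * 6)) ^+ 2 * N%:R = e ^+ 2 / (64 * 600) * N%:R.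
    by field.
  rewrite expRD; apply: ler_wpM2r; first exact: expR_ge0.
  by rewrite expRM_natl lnK ?posrE // -natrX -natrM ler_nat.
rewrite expR_lt1 subr_lt0.
have q0 : 0 < 64 * 600 :> R by rewrite mulr_gt0 ?ltr0n.
move: (64 * 600) q0 hN => q q0 hN.
have -> : e ^+ 2 / q * N%:R = N%:R / (q * e ^- 2) by field; rewrite !gt_eqF.
rewrite ltr_pdivlMr ?mulr_gt0 ?invr_gt0 ?exprn_gt0 //.
by apply: le_lt_trans hN; rewrite le_eqVlt; apply/orP; left; apply/eqP; ring.
Qed.

Theorem theorem22 (R : realType) (k : nat) (c : R) (k_gt0 : (0 < k)%N)
    (c_gt0 : 0 < c) :
  exists K : R, 0 < K /\
  forall (eps : R) (d n m l : nat) (T : 'I_n -> plcurve R d),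
    0 < eps < 1 -> (0 < d)%N -> (0 < n)%N -> (2 <= l)%N -> (l < m)%N ->
    injective T ->
    (forall i, polygonal (T i) /\ (complexity (T i) <= m)%N) ->
  exists d' : nat,
    [/\ (0 < d')%N,
        d'%:R <= K * (eps ^- 2 * l%:R * ln (n * m)%:R) &
  exists P : probability (borel_matrix R d d') R,
  exists E : set (borel_matrix R d d'),
    [/\ measurable E,
        ((1 - (n * m)%:R `^ (- c))%:E <= P E)%E &
  forall A : 'M[R]_(d, d'), E A ->
    let FT := fun i => map_vertices (mulmxr A) (T i) in
    (1 - eps) / (6 * (1 + eps)) * median_opt k l T <= median_opt k l FT /\
    median_opt k l FT <= (1 + eps) * median_opt k l T]].
Proof.
pose B : R := (13 + 6 * k)%:R.
have B0 : 0 <= B by rewrite ler0n.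
have [q [qE q0]] : exists q : R, q = 64 * 600 /\ 0 < q.
  by eexists; split; [reflexivity|rewrite mulr_gt0 ?ltr0n].
have qB0 : 0 <= q * B by rewrite mulr_ge0 // ltW.
exists (q * B + 4); split; first by rewrite ltr_wpDl.
move=> eps d n m l T /andP[e0 e1] d0 n0 l1 lm _ Tm.
pose y := eps ^- 2 * ln (n * m)%:R.
have y_ge : 1 / 2 <= y.
  have m2 : 1 / 2 <= ln (n * m)%:R :> R.
    apply: ln_ge_half; rewrite ler_nat.
    by rewrite (leq_trans (ltnW (leq_ltn_trans l1 lm))) // leq_pmull.
  apply: (le_trans m2); rewrite /y ler_peMl //; first by apply: le_trans m2.
  by rewrite invf_ge1 ?exprn_gt0 // exprn_ile1 ?ltW.
set D := (q * B + 4) * _.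
(* The summand 4 in the constant yields [4 * y >= 2], which leaves room for rounding the dimension
   up. *)
have D_ge : q * B * y + 2 <= D.
  have -> : D = (q * B + 4) * y * l%:R by rewrite /D /y; ring.
  have l1' : 1 <= l%:R :> R by rewrite ler1n ltnW.
  apply: (@le_trans _ _ ((q * B + 4) * y)); first by rewrite mulrDl lerD2l; lra.
  by rewrite ler_peMr // mulr_ge0 //; lra.
have qBy0 : 0 <= q * B * y by rewrite mulr_ge0 //; lra.
suff [N [N0 ND [A [low up]]]] : exists N : nat, [/\ (0 < N)%N, N%:R <= D &
    exists A : 'M[R]_(d, N), let FT := fun i => map_vertices (mulmxr A) (T i) in
    median_opt k l T <= 6 * median_opt k l FT /\
    median_opt k l FT <= (1 + eps) * median_opt k l T].
  exists N; split=> //; exists (dirac (A : borel_matrix R d N)), [set A]; split.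
  - exact: measurable_singleton.
  - rewrite [leRHS]diracE mem_set // lee_fin lerBlDr lerDl.
    exact: powR_ge0.
  - move=> _ -> /=; split => //.
    have r0 := median_opt_ge0 k l T.
    have c1 : (1 - eps) / (6 * (1 + eps)) <= 6^-1 by rewrite ler_pdivrMr; lra.
    by apply: (le_trans (ler_wpM2r r0 c1)); lra.
have [d1|d1] := leqP d 1.
  have {d0 d1} dE : d = 1%N by apply/eqP; rewrite eqn_leq d1.
  subst d; exists 1%N; split => //; first by lra.
  exists 1%:M => FT; have -> : FT = T by apply/funext => i; exact: map_vertices1.
  by have := median_opt_ge0 k l T => r0; split; nra.
have e4 : 0 < eps / 4 by rewrite divr_gt0.
have [C CP Copt] := near_optimal_candidate T d1 k_gt0 l1 e4.
have [g [gC Cg]] := median_candidate_enum CP.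
have gl j : (complexity (g j) <= l)%N by have [_] := CP.2 _ (gC j).
(* Adding 2 exceeds the real bound and also gives [1 < N], which general position in the image space
   requires. *)
pose N := (Num.trunc (q * B * y)).+2.
have /andP[N1 N2] := truncn_itv qBy0.
have NE : N%:R = (Num.trunc (q * B * y))%:R + 2 :> R by rewrite /N -addn2 natrD.
have N_gt : q * B * y < N%:R by apply: (lt_trans N2); rewrite ltr_nat.
exists N; split => //; first by lra.
(* Vertices of all input curves and centres; shorter vertex lists are padded with the default 0 of
   [nth]. *)
pose pt (j : 'I_n * 'I_m + 'I_k * 'I_l) : 'rV[R]_d := match j with
  | inl ia => (vertices (T ia.1))`_ia.2
  | inr ja => (vertices (g ja.1))`_ja.2 end.
have h01 : 0 < eps / 2 <= 1 by apply/andP; split; lra.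
rewrite qE in N_gt.
have [A hA] := embed_combinations pt h01 (isT : (0 < 6)%N)
  (dimension_suffices k_gt0 n0 l1 lm e0 N_gt).
exists A => FT.
have Tp i : through_points pt (T i).
  by apply: (@through_points_nth _ _ _ _ pt (fun a => inl (i, a))); [case: (Tm i)|].
have gp j : through_points pt (g j).
  exact: (@through_points_nth _ _ _ _ pt (fun a => inr (j, a))).
have eps01 : 0 < eps < 1 by rewrite e0.
have [low up0 upC] :=
  near_isometry_median eps01 hA d1 (isT : (1 < N)%N) k_gt0 l1 n0 gC Cg gl Tp gp.
split => //; have := median_opt_ge0 k l T; rewrite le_eqVlt => /predU1P[r0|r0].
  by apply: (le_trans up0); rewrite -r0 !mulr0.
apply: (le_trans upC); have c0 : 0 <= 1 + eps / 4 by lra.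
apply: (le_trans (ler_wpM2l c0 (Copt r0))); rewrite mulrA ler_wpM2r ?ltW //.
(* It remains to see that [(1 + eps / 4) ^+ 2 <= 1 + eps]: one factor comes from the near-isometry,
   the other from the near-optimality of [C]. *)
have : eps * eps <= eps by rewrite ler_piMl ?ltW.
by lra.
Qed.
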